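(* Let $F:\mathbb{R}^n\to\mathbb{R}^m$ be a centered stationary Gaussian random field as below, with spectral measure $\rho$ and spectral random measure $Z$. If $Z$ is $m$-balls absolute non-degenerate, then $\mathcal{H}_0(\rho)$ is $C^1$-dense in $C^1(B,\mathbb{R}^m)$ for every bounded open set $B\subset\mathbb{R}^n$, i.e. for every $G\in C^1(B,\mathbb{R}^m)$ and $\epsilon>0$ there is $H\in\mathcal{H}_0(\rho)$ with $\|H-G\|_{C^1(B)}<\epsilon$.
   Context: $F=(f_1,\dots,f_m)$ is a centered stationary Gaussian field, a.s. $C^{3-}$, with covariance $k_{i_1i_2}(x-y)=\mathcal{E}(f_{i_1}(x)f_{i_2}(y))$. Its spectral measure $\rho=(\rho_{i_1i_2})$ is the finite positive semi-definite matrix-valued measure on $\mathbb{R}^n$ with $k_{i_1i_2}(x)=\int e^{i\langle x,\xi\rangle}d\rho_{i_1i_2}(\xi)$, and $F(x)=\int e^{i\langle x,\xi\rangle}dZ(\xi)$ for a centered $\mathbb{C}^m$-valued orthogonal random measure $Z$ with $\mathcal{E}(Z_{i_1}(U_1)\overline{Z_{i_2}(U_2)})=\rho_{i_1i_2}(U_1\cap U_2)$. $L^2_H(\rho)$ is the set of $G=(g_1,\dots,g_m):\mathbb{R}^n\to\mathbb{C}^m$ with $\sum_{i_1,i_2}\int g_{i_1}\overline{g_{i_2}}\,d\rho_{i_1i_2}<\infty$ and $G(-x)=\overline{G(x)}$. For $G\in L^2_H(\rho)$, $\mathcal{F}_\rho(G)$ has components $(\mathcal{F}_\rho(G))_{i_2}(x)=\sum_{i_1}\int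 e^{-i\langle x,\xi\rangle}g_{i_1}(\xi)\,d\rho_{i_1i_2}(\xi)$, and $\mathcal{H}_0(\rho)=\mathcal{F}_\rho(L^2_H(\rho))$. $Z$ is $m$-balls absolute non-degenerate if there are open balls $B_{r_1}(y_1),\dots,B_{r_m}(y_m)$ such that for each $t$ and every nonempty open $U\subset B_{r_t}(y_t)$ there are complex constants $c_{t1}(U),\dots,c_{tm}(U)$ with $\sum_ic_{ti}(U)\rho_{is}(U)=\delta_{ts}$ for all $s$ (equivalently $Z_t(U)\notin\mathrm{Span}_{\mathbb{C}}\{Z_s(U):s\neq t\}$), and there are constants $C_1(Z),C_2(Z)>0$ with $|\rho_{st}|(V)\le C_1(Z)|\rho_{st}(V)|$ for all $s,t$ and all open $V\subset\bigcup_iB_{r_i}(y_i)$, and $\sum_i|c_{ti}(U)\rho_{is}(U)|\le C_2(Z)$ for all $s,t$ and open $U\subset B_{r_t}(y_t)$.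
   Formalization: G is assumed C^1 on an open neighbourhood of the closure of B, not merely on B; for G only in C^1(B) the claim fails (e.g. G(x)=1/x on B=(0,1), while every element of H_0(ρ) is bounded). *)

(* Defs.v *)
From HB Require Import structures.
From mathcomp Require Import all_boot all_order all_algebra.
From mathcomp Require Import complex.
From mathcomp Require Import all_classical all_reals all_analysis.
Set Implicit Arguments. Unset Strict Implicit. Unset Printing Implicit Defensive.
Import Order.TTheory GRing.Theory Num.Theory.
Import numFieldNormedType.Exports.
Local Open Scope classical_set_scope.
Local Open Scope ring_scope.

Section Defs.
Variable R : realType.

(** R^n is ['rV[R]_n] (product topology = Euclidean topology).  For measure
    theory we use the Borel sigma-algebra, generated by the open sets. *)
Definition BRn (n : nat) := g_sigma_algebraType (@open ('rV[R]_n)).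

Definition dotp n (x y : 'rV[R]_n) : R := \sum_(j < n) x 0 j * y 0 j.
Definition eball n (y : 'rV[R]_n) (r : R) : set 'rV[R]_n :=
  [set x | \sum_(j < n) (x 0 j - y 0 j) ^+ 2 < r ^+ 2].

Definition cabs (z : R[i]) : R := Normc.normc z.
Definition cexpi (t : R) : R[i] := Complex (cos t) (sin t).

Definition cintegral d (T : measurableType d) (mu : {measure set T -> \bar R})
  (D : set T) (f : T -> R[i]) : R[i] :=
  Complex (Rintegral mu D (fun x => complex.Re (f x))) (Rintegral mu D (fun x => complex.Im (f x))).

Definition evec n (j : 'I_n) : 'rV[R]_n := delta_mx 0 j.
Definition partial n (f : 'rV[R]_n -> R) (j : 'I_n) (x : 'rV[R]_n) : R :=
  derive f x (evec j).

Definition C1on n (U : set 'rV[R]_n) (f : 'rV[R]_n -> R) : Prop :=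
  forall x, U x ->
    {for x, continuous f} /\
    (forall j, derivable f x (evec j)) /\
    (forall j, {for x, continuous (partial f j)}).

Definition C3minus n (f : 'rV[R]_n -> R) : Prop :=
  (forall x j, derivable f x (evec j)) /\
  (forall x j l, derivable (partial f j) x (evec l)) /\
  (forall j l (a : R), 0 < a < 1 -> forall r : R, 0 < r ->
     exists C : R, forall x y : 'rV[R]_n, `|x| <= r -> `|y| <= r ->
       `|partial (partial f j) l x - partial (partial f j) l y|
          <= C * powR `|x - y| a).

Definition C1dist n m (B : set 'rV[R]_n) (H G : 'I_m -> 'rV[R]_n -> R) : \bar R :=
  (ereal_sup [set z | exists i x, B x /\ z = (`|H i x - G i x|)%:E] +
   ereal_sup [set z | exists i j x, B x /\
                 z = (`|partial (H i) j x - partial (G i) j x|)%:E])%E.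

Section Field.
Context d (Omega : measurableType d) (P : probability Omega R).

Definition gaussian_rv (X : Omega -> R) : Prop :=
  exists (a s : R), 0 <= s /\
    forall A : set R, measurable A ->
      P (X @^-1` A) = (if s == 0 then \d_a A else normal_prob a s A).

Context n m (F : 'I_m -> 'rV[R]_n -> {RV P >-> R}).

Definition centered_gaussian_field : Prop :=
  (forall i x, (\int[P]_w (F i x w)%:E = 0)%E) /\
  (forall s : seq ('I_m * 'rV[R]_n * R),
     gaussian_rv (fun w => \sum_(p <- s) p.2 * F p.1.1 p.1.2 w)).

Definition stationary_cov (k : 'I_m -> 'I_m -> 'rV[R]_n -> R) : Prop :=
  forall i1 i2 x y,
    (\int[P]_w (F i1 x w * F i2 y w)%:E = (k i1 i2 (x - y))%:E)%E.

Definition as_C3minus : Prop :=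
  {ae P, forall w, forall i, C3minus (fun x => F i x w)}.
End Field.

(** rho_{i j} is represented by a complex density h_{i j} w.r.t. a finite
    measure mu :  rho_{i j}(U) = \int_U h_{i j} dmu. *)
Section Spectral.
Context n m (mu : {finite_measure set (BRn n) -> \bar R})
  (h : 'I_m -> 'I_m -> BRn n -> R[i]).

Definition rho (i j : 'I_m) (U : set (BRn n)) : R[i] := cintegral mu U (h i j).

Definition rho_int (i j : 'I_m) (g : BRn n -> R[i]) : R[i] :=
  cintegral mu setT (fun xi => g xi * h i j xi).

Definition rho_tv (i j : 'I_m) (V : set (BRn n)) : \bar R :=
  ereal_sup [set z | exists (K : nat) (A : 'I_K -> set (BRn n)),
     (forall l, measurable (A l)) /\ trivIset setT A /\
     \bigcup_l A l = V /\ z = (\sum_(l < K) cabs (rho i j (A l)))%:E].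

Definition finite_psd_matrix_measure : Prop :=
  (forall i j, measurable_fun setT (fun xi => complex.Re (h i j xi)) /\
               measurable_fun setT (fun xi => complex.Im (h i j xi))) /\
  (forall i j, (\int[mu]_xi (cabs (h i j xi))%:E < +oo)%E) /\
  (forall U, measurable U -> forall c : 'I_m -> R[i],
     0 <= \sum_(i < m) \sum_(j < m) c i * Num.conj (c j) * rho i j U).

Definition spectral_measure_of (k : 'I_m -> 'I_m -> 'rV[R]_n -> R) : Prop :=
  finite_psd_matrix_measure /\
  forall i j x, real_complex R (k i j x) = rho_int i j (fun xi => cexpi (dotp x xi)).

Definition L2H (G : 'I_m -> BRn n -> R[i]) : Prop :=
  (forall i, measurable_fun setT (fun xi => complex.Re (G i xi)) /\
             measurable_fun setT (fun xi => complex.Im (G i xi))) /\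
  (forall i1 i2, (\int[mu]_xi
      (cabs (G i1 xi * Num.conj (G i2 xi) * h i1 i2 xi))%:E < +oo)%E) /\
  (forall xi i, G i (- xi) = Num.conj (G i xi)).

Definition F_rho (G : 'I_m -> BRn n -> R[i]) (i2 : 'I_m) (x : 'rV[R]_n) : R[i] :=
  \sum_(i1 < m) rho_int i1 i2 (fun xi => cexpi (- dotp x xi) * G i1 xi).

(** H_0(rho) = F_rho(L^2_H(rho)) (these functions are real-valued) *)
Definition H0 : set ('I_m -> 'rV[R]_n -> R) :=
  [set H | exists G, L2H G /\ forall i x, real_complex R (H i x) = F_rho G i x].

(** m-balls absolute non-degeneracy (stated on rho, i.e. on the covariance of Z) *)
Definition m_balls_abs_nondeg : Prop :=
  exists (y : 'I_m -> 'rV[R]_n) (r : 'I_m -> R)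
         (c : 'I_m -> set 'rV[R]_n -> 'I_m -> R[i]) (C1 C2 : R),
    (forall t, 0 < r t) /\ 0 < C1 /\ 0 < C2 /\
    (forall t (U : set 'rV[R]_n), open U -> U !=set0 -> U `<=` eball (y t) (r t) ->
       forall s, \sum_(i < m) c t U i * rho i s U = (t == s)%:R) /\
    (forall s t (V : set 'rV[R]_n), open V -> V `<=` \bigcup_i eball (y i) (r i) ->
       (rho_tv s t V <= (C1 * cabs (rho s t V))%:E)%E) /\
    (forall s t (U : set 'rV[R]_n), open U -> U `<=` eball (y t) (r t) ->
       \sum_(i < m) cabs (c t U i * rho i s U) <= C2).
End Spectral.
End Defs.

(* Main.v *)
Require Import Defs.
From HB Require Import structures.
From mathcomp Require Import all_boot all_order all_algebra.
From mathcomp Require Import complex ring lra finmap.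
From mathcomp Require Import all_classical all_reals all_analysis measurable_realfun.
Set Implicit Arguments. Unset Strict Implicit. Unset Printing Implicit Defensive.
Import Order.TTheory GRing.Theory Num.Theory.
Import numFieldNormedType.Exports.
Local Open Scope classical_set_scope.
Local Open Scope ring_scope.

(** Let U be a small open cell around a point xi0 of the t-th ball, c = c_t(U) and a a complex
    number. The Hermitian step function G_i = a c_i 1_U + conj(a c_i) 1_(-U) lies in L^2_H.
    Since rho(-U) = conj rho(U), F_rho(G)_s(x) is twice the real part of
    a sum_i c_i int_U e^(-i<x,xi>) d rho_is, and by sum_i c_i rho_is(U) = delta_ts this tends to
    2 delta_ts Re (a e^(-i<x,xi0>)) as U shrinks to xi0, in C^1 on bounded sets: the two uniform
    constants bound the total variation of sum_i c_i rho_is on U independently of U. So the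
    C^1-closure of H_0 contains the functions cos(<x,xi0> + b) e_t with xi0 in the t-th ball.

    Their span is C^1-dense. A C^1 function is a C^1-limit of polynomials on a box (Bernstein, one
    coordinate at a time), and x_j is the limit of sin(d x_j) / d, so every C^1 function is a limit
    of trigonometric sums with arbitrarily small frequencies; applying this to f cos<x,y> and
    f sin<x,y> moves the frequencies close to any y.

    The symmetry of rho is where the Fourier transform has to be inverted. Call a real function
    psi symmetric if int e^(i<x,xi>) psi(xi) d rho is conjugate to int e^(i<x,xi>) psi(-xi) d rho
    for all x; the constant 1 is, because k is real. The multipliers preserving symmetry form an
    algebra closed under bounded pointwise limits and containing all cosines, hence they include
    the indicators of half-spaces and of cells. *)

(** The hypotheses control rho only on the m balls, while a Hermitian G living on a cell U also
    charges -U, where neither the duality nor the total variation bound is assumed; moreover members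
    of H_0 must be real functions. The symmetry of rho settles both: the integral over -U is the
    conjugate of the integral over U. The coefficients c_ti(U) may blow up as U shrinks. Only the
    products c_ti(U) rho_is(U) stay bounded, so |rho_is|(U) is first compared with |rho_is(U)| and
    only then multiplied by |c_ti(U)|. Bernstein sums are used because differentiating one gives a
    Bernstein sum of difference quotients, so a single Chebyshev estimate controls values and
    derivatives. Small frequencies suffice because closeness is asked only on a bounded box. *)

Section pointwise_derivative.
Context {R : realType} {V : normedModType R}.
Implicit Types (f g : V -> R) (x v : V).

Lemma derD f g x v df dg : is_derive x v f df -> is_derive x v g dg ->
  is_derive x v (fun z => f z + g z) (df + dg).
Proof. by move=> ? ?; exact: is_deriveD. Qed.

Lemma derM f g x v df dg : is_derive x v f df -> is_derive x v g dg ->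
  is_derive x v (fun z => f z * g z) (f x * dg + g x * df).
Proof. by move=> ? ?; exact: (@is_deriveM _ _ f g). Qed.

Lemma derN f x v df : is_derive x v f df -> is_derive x v (fun z => - f z) (- df).
Proof. by move=> ?; exact: is_deriveN. Qed.

Lemma dercst (c : R) x v : is_derive x v (fun _ => c) 0.
Proof. exact: is_derive_cst. Qed.

End pointwise_derivative.

Lemma der_affine {R : realType} (a b t : R) : is_derive t 1 (fun s => s * a + b) a.
Proof.
have := derD (derM (is_derive_id t 1) (dercst a t 1)) (dercst b t 1).
by rewrite mulr0 add0r mulr1 addr0.
Qed.

(** * Calculus of C^1 functions on R^n and uniform bounds on boxes *)

Section C1.
Context {R : realType} {n : nat}.
Local Notation V := 'rV[R]_n.
Implicit Types (f g : V -> R) (x v : V).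

Lemma is_derive_line f x v df :
  is_derive x v f df <-> is_derive (0 : R) 1 (fun t => f (t *: v + x)) df.
Proof.
have E : (fun h : R => h^-1 *: (((fun t => f (t *: v + x)) \o shift 0) (h *: 1) -
    (fun t => f (t *: v + x)) 0)) =
  (fun h : R => h^-1 *: ((f \o shift x) (h *: v) - f x)).
  by apply/funext => h /=; rewrite addr0 scale0r add0r /GRing.scale /= mulr1.
by split=> -[H1 H2]; split; move: H1 H2; rewrite /derivable /derive E.
Qed.

Lemma is_derive_compR (phi : R -> R) f x v df dphi :
  is_derive x v f df -> is_derive (f x) 1 phi dphi ->
  is_derive x v (fun z => phi (f z)) (dphi * df).
Proof.
move=> /is_derive_line f' phi'; apply/is_derive_line.
have phi2 : is_derive (f (0 *: v + x)) 1 phi dphi by rewrite scale0r add0r.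
exact: (@is_derive1_comp _ phi (fun t => f (t *: v + x)) 0 dphi df).
Qed.

Lemma C1_intro f (df : 'I_n -> V -> R) : continuous f ->
  (forall x j, is_derive x (evec R j) f (df j x)) ->
  (forall j, continuous (df j)) -> C1on setT f.
Proof.
move=> cf f' cdf x _; split; first exact: cf.
split=> j; first by have [] := f' x j.
have -> : partial f j = df j by apply/funext => z; have [_ <-] := f' z j.
exact: cdf.
Qed.

Lemma partialE f df j x : is_derive x (evec R j) f df -> partial f j x = df.
Proof. by case. Qed.

Lemma C1_cont f : C1on setT f -> continuous f.
Proof. by move=> C x; have [] := C x I. Qed.

Lemma C1_der f : C1on setT f -> forall x j, is_derive x (evec R j) f (partial f j x).
Proof. by move=> C x j; have [_ [/(_ j) d _]] := C x I; exact: derivableP. Qed.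

Lemma C1_dcont f : C1on setT f -> forall j, continuous (partial f j).
Proof. by move=> C j x; have [_ [_ /(_ j)]] := C x I. Qed.

Lemma contD f g : continuous f -> continuous g -> continuous (fun z => f z + g z).
Proof. by move=> cf cg x; exact: (cvgD (cf x) (cg x)). Qed.
Lemma contM f g : continuous f -> continuous g -> continuous (fun z => f z * g z).
Proof. by move=> cf cg x; exact: (cvgM (cf x) (cg x)). Qed.
Lemma contcst (c : R) : continuous (fun _ : V => c).
Proof. by move=> x; exact: (@cst_continuous V R c x). Qed.
Lemma contcomp (phi : R -> R) f : continuous phi -> continuous f -> continuous (fun z => phi (f z)).
Proof. by move=> cp cf x; exact: (cvg_comp _ _ (cf x) (cp (f x))). Qed.

Lemma C1D f g : C1on setT f -> C1on setT g -> C1on setT (fun z => f z + g z).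
Proof.
move=> Cf Cg; apply: (@C1_intro _ (fun j x => partial f j x + partial g j x)).
- by apply: contD; apply: C1_cont.
- by move=> x j; apply: derD; exact: C1_der.
- by move=> j; apply: contD; apply: C1_dcont.
Qed.

Lemma C1M f g : C1on setT f -> C1on setT g -> C1on setT (fun z => f z * g z).
Proof.
move=> Cf Cg.
apply: (@C1_intro _ (fun j x => f x * partial g j x + g x * partial f j x)).
- by apply: contM; apply: C1_cont.
- by move=> x j; apply: derM; exact: C1_der.
- move=> j; exact: (contD (contM (C1_cont Cf) (C1_dcont Cg (j := j)))
    (contM (C1_cont Cg) (C1_dcont Cf (j := j)))).
Qed.

Lemma C1cst (c : R) : C1on setT (fun _ : V => c).
Proof.
apply: (@C1_intro _ (fun _ _ => 0)); first exact: contcst.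
by move=> ?; exact: contcst.
Qed.

Lemma partialcst (c : R) j x : partial (fun _ : V => c) j x = 0.
Proof. by apply: partialE; exact: is_derive_cst. Qed.

Lemma coord_cont (j : 'I_n) : continuous (fun x : V => x 0 j).
Proof. by move=> x; exact: coord_continuous. Qed.

Lemma coord_der (i : 'I_n) x v : is_derive x v (fun z : V => z 0 i) (v 0 i).
Proof.
apply/is_derive_line.
have -> : (fun t : R => (t *: v + x) 0 i) = (fun t => t * v 0 i + x 0 i).
  by apply/funext => t; rewrite !mxE.
exact: der_affine.
Qed.

Lemma evecE (i j : 'I_n) : evec R j 0 i = (i == j)%:R.
Proof. by rewrite /evec mxE eqxx. Qed.

Lemma dotpDr x y z : dotp x (y + z) = dotp x y + dotp x z.
Proof. by rewrite /dotp -big_split; apply: eq_bigr => i _; rewrite mxE mulrDr. Qed.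
Lemma dotpDl x y z : dotp (x + y) z = dotp x z + dotp y z.
Proof. by rewrite /dotp -big_split; apply: eq_bigr => i _; rewrite mxE mulrDl. Qed.
Lemma dotpC x y : dotp x y = dotp y x.
Proof. by apply: eq_bigr => i _; rewrite mulrC. Qed.
Lemma dotpNr x y : dotp x (- y) = - dotp x y.
Proof. by rewrite /dotp -sumrN; apply: eq_bigr => i _; rewrite mxE mulrN. Qed.
Lemma dotpNl x y : dotp (- x) y = - dotp x y.
Proof. by rewrite dotpC dotpNr dotpC. Qed.
Lemma dotpZr x (a : R) y : dotp x (a *: y) = a * dotp x y.
Proof. by rewrite /dotp mulr_sumr; apply: eq_bigr => i _; rewrite mxE mulrCA. Qed.
Lemma dotpZl x (a : R) y : dotp (a *: x) y = a * dotp x y.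
Proof. by rewrite dotpC dotpZr dotpC. Qed.
Lemma dotp_evec x j : dotp x (evec R j) = x 0 j.
Proof.
rewrite /dotp (bigD1 j)//= big1 ?addr0 ?evecE ?eqxx ?mulr1// => i /negPf ij.
by rewrite evecE ij mulr0.
Qed.
Lemma dotp0r x : dotp x 0 = 0.
Proof. by rewrite /dotp big1 // => i _; rewrite mxE mulr0. Qed.

Lemma contsum (I : Type) (s : seq I) (F : I -> V -> R) :
  (forall i, continuous (F i)) -> continuous (fun x => \sum_(i <- s) F i x).
Proof.
move=> cF; elim: s => [|i s IH].
  by under eq_fun do rewrite big_nil; exact: contcst.
by under eq_fun do rewrite big_cons; apply: contD.
Qed.

Lemma dotp_cont y : continuous (fun x => dotp x y).
Proof.
by apply: contsum => i; apply: contM; [exact: coord_cont|exact: contcst].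
Qed.

Lemma dotp_der x v y : is_derive x v (fun z => dotp z y) (dotp v y).
Proof.
apply/is_derive_line.
have -> : (fun t : R => dotp (t *: v + x) y) = (fun t => t * dotp v y + dotp x y).
  by apply/funext => t; rewrite dotpDl dotpZl.
exact: der_affine.
Qed.

Lemma C1comp (phi dphi : R -> R) f : continuous phi -> continuous dphi ->
  (forall t : R, is_derive t 1 phi (dphi t)) -> C1on setT f ->
  C1on setT (fun z => phi (f z)).
Proof.
move=> cp cdp dp Cf; apply: (@C1_intro _ (fun j x => dphi (f x) * partial f j x)).
- by apply: contcomp => //; apply: C1_cont.
- by move=> x j; exact: (is_derive_compR (C1_der Cf x j) (dp _)).
- move=> j; apply: contM; last by apply: C1_dcont.
  by apply: contcomp => //; apply: C1_cont.
Qed.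

Lemma C1coord (i : 'I_n) : C1on setT (fun x : V => x 0 i).
Proof.
apply: (@C1_intro _ (fun j _ => evec R j 0 i)); first exact: coord_cont.
  by move=> x j; exact: coord_der.
by move=> j; exact: contcst.
Qed.

Lemma partial_coord (i j : 'I_n) x : partial (fun z : V => z 0 i) j x = (i == j)%:R.
Proof. by rewrite (partialE (coord_der i x _)) evecE. Qed.

Lemma C1dotp y : C1on setT (fun x : V => dotp x y).
Proof.
apply: (@C1_intro _ (fun j _ => dotp (evec R j) y)); first exact: dotp_cont.
  by move=> x j; exact: dotp_der.
by move=> j; exact: contcst.
Qed.

Lemma partialM f g j x : C1on setT f -> C1on setT g ->
  partial (fun z => f z * g z) j x = f x * partial g j x + g x * partial f j x.
Proof. by move=> Cf Cg; apply: partialE; apply: derM; exact: C1_der. Qed.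

(** Approximation is measured on these sets: they are compact, exhaust the bounded sets, and are
    stable under replacing one coordinate, as coordinatewise interpolation requires. *)
Definition box (L : R) : set V := [set x | forall j, `|x 0 j| <= L].

Lemma box_compact L : compact (box L).
Proof.
have -> : box L = [set v : V | forall i, `[- L, L]%classic (v ord0 i)].
  by apply/seteqP; split=> x H i; move: (H i); rewrite /= in_itv/= ler_norml.
by apply: (@rV_compact _ _ (fun=> `[- L, L]%classic)) => i; exact: segment_compact.
Qed.

Lemma box_bounded L f : continuous f -> exists M, 0 < M /\ forall x, box L x -> `|f x| <= M.
Proof.
move=> cf.
have cK : compact (f @` box L).
  by apply: continuous_compact; [exact: continuous_subspaceT|exact: box_compact].
have [M [Mr HM]] := compact_bounded cK.
exists (`|M| + 1); split; first by rewrite ltr_wpDl.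
move=> x Kx; apply: HM; last by exists x.
by rewrite (le_lt_trans (ler_norm M))// ltrDl.
Qed.

Lemma rV_ballP (x y : V) (e : R) : 0 < e -> ball x e y <-> forall j, `|x 0 j - y 0 j| < e.
Proof.
move=> e0; split=> [[_ H] j|H]; first exact: H.
by split=> // i j; rewrite !ord1; exact: H.
Qed.

(** Heine-Cantor, with only x confined to the box. Half of the local radius of continuity is spent
    on reaching x, the other half on the step from x to y. *)
Lemma box_unif (L : R) f (e : R) : continuous f -> 0 < e ->
  exists d : R, 0 < d /\ forall x y : V, box L x ->
    (forall j, `|x 0 j - y 0 j| < d) -> `|f x - f y| < e.
Proof.
move=> cf e0.
have /compact_near_coveringP nc := @box_compact L.
have H : \forall d \near (0:R)^'+,
  box L `<=` [set x : V | forall y : V, (forall j, `|x 0 j - y 0 j| < d) -> `|f x - f y| < e].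
  apply: nc => x Kx.
  have e2 : 0 < e / 2 by rewrite divr_gt0.
  have /cvgrPdist_lt/(_ _ e2)/nbhs_ballP[r /= r0 Hr] := cf x.
  have r2 : 0 < r / 2 by rewrite divr_gt0.
  exists (ball x (r / 2), [set t | t < r / 2]).
    by split; [exact: nbhsx_ballx|exact: nbhs_right_lt].
  case=> x' t [/= xx' tr] y xy.
  have yb : ball x r y.
    apply/rV_ballP => // j; have := (rV_ballP _ _ r2).1 xx' j; have := xy j.
    by have := ler_distD (x' 0 j) (x 0 j) (y 0 j); move: tr; lra.
  have xb : ball x r x'.
    by apply: le_ball xx'; lra.
  have := Hr _ yb; have := Hr _ xb => /=.
  by have := ler_distD (f x) (f x') (f y); rewrite (distrC (f x') (f x)); lra.
have [d [d0 Hd]] : exists d : R, 0 < d /\ box L `<=` [set x : V | forall y : V,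
    (forall j, `|x 0 j - y 0 j| < d) -> `|f x - f y| < e].
  have [d [d0 Hd]] := filter_ex (filterI (nbhs_right_gt (0:R)) H).
  by exists d.
by exists d; split => // x y Kx; exact: Hd.
Qed.

Definition clo (L : R) f g (e : R) := forall x, box L x ->
  `|f x - g x| <= e /\ forall j, `|partial f j x - partial g j x| <= e.

End C1.

(** * Trigonometric sums and approximation with arbitrarily small frequencies *)

Section trig.
Context {R : realType} {n : nat}.
Local Notation V := 'rV[R]_n.
Implicit Types (f g : V -> R) (x v : V).

(** The free phase b makes sines special cosines, so these real sums are stable under products
    without complex exponentials. *)
Inductive trig (Xi : set V) : (V -> R) -> Prop :=
| trig_cos (A b : R) xi : Xi xi -> trig Xi (fun x => A * cos (dotp x xi + b))
| trig_add f g : trig Xi f -> trig Xi g -> trig Xi (fun x => f x + g x).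

Lemma C1cos (b : R) xi : C1on setT (fun x : V => cos (dotp x xi + b)).
Proof.
apply: (@C1comp _ _ (@cos R) (fun t => - sin t)).
- exact: continuous_cos.
- by move=> t; apply: (@continuousN _ _ _ (@sin R)); exact: continuous_sin.
- by apply: C1D; [exact: C1dotp|exact: C1cst].
Qed.

Lemma partial_cos (b : R) xi j x :
  partial (fun x : V => cos (dotp x xi + b)) j x = - xi 0 j * sin (dotp x xi + b).
Proof.
apply: partialE.
have := is_derive_compR (derD (dotp_der x (evec R j) xi) (dercst b x (evec R j)))
   (is_derive_cos (dotp x xi + b)).
by rewrite (dotpC (evec R j)) dotp_evec addr0 mulNr mulrC mulNr.
Qed.

Lemma trig_C1 Xi f : trig Xi f -> C1on setT f.
Proof.
elim=> [A b xi _|{}f g _ Cf _ Cg]; last exact: C1D.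
by apply: C1M; [exact: C1cst|exact: C1cos].
Qed.

(** Product-to-sum formula. Since cosine is even, the difference of frequencies can be taken as eta
    - xi, which stays near eta when xi is small; the set Zi need not contain anything near -eta. *)
Lemma trig_mul Xi Yi Zi f g :
  (forall xi eta, Xi xi -> Yi eta -> Zi (eta + xi) /\ Zi (eta - xi)) ->
  trig Xi f -> trig Yi g -> trig Zi (fun x => f x * g x).
Proof.
move=> XYZ; elim=> [A a xi Xxi|f1 f2 _ IH1 _ IH2] tg; last first.
  have -> : (fun x => (f1 x + f2 x) * g x) = (fun x => f1 x * g x + f2 x * g x).
    by apply/funext => x; rewrite mulrDl.
  by apply: trig_add; [exact: IH1|exact: IH2].
elim: tg => [B b eta Yeta|g1 g2 _ IH1 _ IH2]; last first.
  have -> : (fun x => A * cos (dotp x xi + a) * (g1 x + g2 x)) =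
    (fun x => A * cos (dotp x xi + a) * g1 x + A * cos (dotp x xi + a) * g2 x).
    by apply/funext => x; rewrite mulrDr.
  exact: trig_add.
have [Zp Zm] := XYZ _ _ Xxi Yeta.
have -> : (fun x => A * cos (dotp x xi + a) * (B * cos (dotp x eta + b))) =
  (fun x => A * B / 2 * cos (dotp x (eta + xi) + (b + a)) +
            A * B / 2 * cos (dotp x (eta - xi) + (b - a))).
  apply/funext => x; rewrite !dotpDr dotpNr.
  have -> : dotp x eta + dotp x xi + (b + a) = (dotp x eta + b) + (dotp x xi + a) by ring.
  have -> : dotp x eta - dotp x xi + (b - a) = (dotp x eta + b) - (dotp x xi + a) by ring.
  move: (dotp x eta + b) (dotp x xi + a) => P Q.
  by rewrite cosB cosD; field.
by apply: trig_add; exact: trig_cos.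
Qed.

Definition cube (y : V) (r : R) : set V := [set xi | forall j, `|xi 0 j - y 0 j| <= r].

Lemma trig_mul_cube y (r1 r2 r : R) f g : r1 + r2 <= r ->
  trig (cube 0 r1) f -> trig (cube y r2) g -> trig (cube y r) (fun x => f x * g x).
Proof.
move=> r12; apply: trig_mul => xi eta Xxi Yeta; split => j;
  have := Xxi j; have := Yeta j; rewrite !mxE; rewrite !ler_norml;
  by move=> /andP[? ?] /andP[? ?]; apply/andP; split; lra.
Qed.

Lemma clo_trans (L : R) f g h (e1 e2 : R) :
  clo L f g e1 -> clo L g h e2 -> clo L f h (e1 + e2).
Proof.
move=> fg gh x Kx; have [a1 b1] := fg x Kx; have [a2 b2] := gh x Kx; split=> [|j].
  by apply: le_trans (ler_distD (g x) _ _) _; exact: lerD.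
by apply: le_trans (ler_distD (partial g j x) _ _) _; exact: lerD.
Qed.

(** [partial] is total, so its additivity needs the derivatives to exist. Continuity of the
    derivatives is not asked, because the members of H_0 built later are only shown to be
    differentiable. *)
Definition derivable_everywhere f := forall x j, derivable f x (evec R j).

Lemma C1_derivable f : C1on setT f -> derivable_everywhere f.
Proof. by move=> Cf x j; case: (C1_der Cf x j). Qed.

Lemma clo_add (L : R) f g f' g' (e1 e2 : R) :
  derivable_everywhere f -> derivable_everywhere g ->
  derivable_everywhere f' -> derivable_everywhere g' ->
  clo L f g e1 -> clo L f' g' e2 ->
  clo L (fun x => f x + f' x) (fun x => g x + g' x) (e1 + e2).
Proof.
move=> Df Dg Df' Dg' fg fg' x Kx.
have [a1 b1] := fg x Kx; have [a2 b2] := fg' x Kx; split=> [|j].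
  by rewrite opprD addrACA; apply: le_trans (ler_normD _ _) _; exact: lerD.
have pD (u w : V -> R) : derivable_everywhere u -> derivable_everywhere w ->
    partial (fun x => u x + w x) j x = partial u j x + partial w j x.
  by move=> Du Dw; apply: partialE; apply: derD; apply: derivableP; [exact: Du|exact: Dw].
rewrite !pD// opprD addrACA.
by apply: le_trans (ler_normD _ _) _; apply: lerD.
Qed.

Lemma C1_box_bounded (L : R) f : C1on setT f -> exists M : R, 0 < M /\
  forall x, box L x -> `|f x| <= M /\ forall j, `|partial f j x| <= M.
Proof.
move=> Cf; have [M0 [M0p HM0]] := box_bounded L (C1_cont Cf).
have /choice[M HM] : forall j, exists M, 0 < M /\ forall x, box L x -> `|partial f j x| <= M.
  by move=> j; apply: box_bounded; apply: C1_dcont.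
have Mp : 0 <= \sum_j M j by apply: sumr_ge0 => j _; apply: ltW; case: (HM j).
exists (M0 + \sum_j M j); split; first by lra.
move=> x Kx; split; first by have := HM0 x Kx; lra.
move=> j; apply: le_trans (proj2 (HM j) x Kx) _.
have S0 : 0 <= \sum_(i | i != j) M i by apply: sumr_ge0 => i _; apply: ltW; case: (HM i).
by rewrite (bigD1 j)//=; lra.
Qed.

Lemma dist_mul_le (a b a' b' M d : R) : `|a| <= M -> `|b| <= M -> d <= 1 ->
  `|a - a'| <= d -> `|b - b'| <= d -> `|a * b - a' * b'| <= (2 * M + 1) * d.
Proof.
move=> aM bM d1 da db.
have -> : a * b - a' * b' = a * (b - b') + b * (a - a') - (a - a') * (b - b') by ring.
apply: le_trans (ler_normB _ _) _; rewrite [leRHS]mulrDl mul1r; apply: lerD; last rewrite normrM.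
  apply: le_trans (ler_normD _ _) _; rewrite !normrM.
  rewrite (_ : 2 * M * d = M * d + M * d); last by ring.
  by apply: lerD; apply: ler_pM.
by rewrite -[leRHS]mul1r; apply: ler_pM => //; apply: le_trans d1.
Qed.

Lemma clo_mul (L : R) f1 f2 (e : R) : C1on setT f1 -> C1on setT f2 -> 0 < e ->
  exists d : R, 0 < d /\ forall g1 g2, C1on setT g1 -> C1on setT g2 ->
    clo L f1 g1 d -> clo L f2 g2 d ->
    clo L (fun x => f1 x * f2 x) (fun x => g1 x * g2 x) e.
Proof.
move=> C1 C2 e0.
have [M1 [M1p H1]] := C1_box_bounded L C1; have [M2 [M2p H2]] := C1_box_bounded L C2.
pose M := M1 + M2.
have Mp : 0 < 2 * (2 * M + 1) by rewrite /M; lra.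
(* A partial derivative of a product has two terms, each perturbed by at most (2 M + 1) d: hence the
   factor 2. The bound d <= 1 absorbs the quadratic error. *)
pose d := Num.min 1 (e / (2 * (2 * M + 1))).
have d1 : d <= 1 by rewrite /d ge_min lexx.
have dp : 0 < d by rewrite /d lt_min ltr01/= divr_gt0.
have de : (2 * M + 1) * d + (2 * M + 1) * d <= e.
  rewrite (_ : _ + _ = d * (2 * (2 * M + 1))); last by ring.
  rewrite -ler_pdivlMr//.
  by rewrite /d ge_min lexx orbT.
have md : 0 <= (2 * M + 1) * d by rewrite mulr_ge0 ?ltW//; rewrite /M; lra.
exists d; split=> // g1 g2 D1 D2 c1 c2 x Kx.
have [a1 b1] := c1 x Kx; have [a2 b2] := c2 x Kx.
have [p1 q1] := H1 x Kx; have [p2 q2] := H2 x Kx.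
have bd (u : R) : u <= M1 \/ u <= M2 -> u <= M by rewrite /M; lra.
split=> [|j].
  have := @dist_mul_le (f1 x) (f2 x) (g1 x) (g2 x) M d.
  by move=> /(_ (bd _ (or_introl p1)) (bd _ (or_intror p2)) d1 a1 a2); lra.
rewrite !partialM//.
have := @dist_mul_le (f1 x) (partial f2 j x) (g1 x) (partial g2 j x) M d
  (bd _ (or_introl p1)) (bd _ (or_intror (q2 j))) d1 a1 (b2 j).
have := @dist_mul_le (f2 x) (partial f1 j x) (g2 x) (partial g1 j x) M d
  (bd _ (or_intror p2)) (bd _ (or_introl (q1 j))) d1 a2 (b1 j).
rewrite opprD addrACA => A B.
by apply: le_trans (ler_normD _ _) _; lra.
Qed.

(** A product adds the frequency bounds of its factors. Asking for every r > 0 lets each factor use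
    r / 2, which makes this class an algebra. *)
Definition trig_approx (L : R) f := C1on setT f /\ forall r e : R, 0 < r -> 0 < e ->
  exists g, trig (cube 0 r) g /\ clo L f g e.

Lemma trig_approx_lim (L : R) f : C1on setT f ->
  (forall e : R, 0 < e -> exists g, trig_approx L g /\ clo L f g e) -> trig_approx L f.
Proof.
move=> Cf H; split=> // r e r0 e0; have e2 : 0 < e / 2 by lra.
have [g [[Cg Hg] fg]] := H _ e2; have [h [th gh]] := Hg _ _ r0 e2.
exists h; split=> //; rewrite [e]splitr; exact: clo_trans fg gh.
Qed.

Lemma trig_approxD (L : R) f g : trig_approx L f -> trig_approx L g ->
  trig_approx L (fun x => f x + g x).
Proof.
move=> [Cf Hf] [Cg Hg]; split; first exact: C1D.
move=> r e r0 e0; have e2 : 0 < e / 2 by lra.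
have [f' [tf' ff']] := Hf _ _ r0 e2; have [g' [tg' gg']] := Hg _ _ r0 e2.
exists (fun x => f' x + g' x); split; first exact: trig_add.
rewrite [e]splitr.
exact: (clo_add (C1_derivable Cf) (C1_derivable (trig_C1 tf'))
  (C1_derivable Cg) (C1_derivable (trig_C1 tg')) ff' gg').
Qed.

Lemma trig_approxM (L : R) f g : trig_approx L f -> trig_approx L g ->
  trig_approx L (fun x => f x * g x).
Proof.
move=> [Cf Hf] [Cg Hg]; split; first exact: C1M.
move=> r e r0 e0; have r2 : 0 < r / 2 by lra.
have [d [d0 Hd]] := clo_mul L Cf Cg e0.
have [f' [tf' ff']] := Hf _ _ r2 d0; have [g' [tg' gg']] := Hg _ _ r2 d0.
exists (fun x => f' x * g' x); split.
  by apply: trig_mul_cube tf' tg'; rewrite -splitr.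
exact: (Hd _ _ (trig_C1 tf') (trig_C1 tg') ff' gg').
Qed.

Lemma trig_approx_cst (L c : R) : trig_approx L (fun _ => c).
Proof.
split=> [|r e r0 e0]; first exact: C1cst.
exists (fun _ => c); split; last first.
  by move=> x _; split=> [|j]; rewrite subrr normr0 ltW.
have -> : (fun _ : V => c) = (fun x => c * cos (dotp x 0 + 0)).
  by apply/funext => x; rewrite dotp0r add0r cos0 mulr1.
by apply: trig_cos => j; rewrite subrr normr0 ltW.
Qed.

(** The two distance conditions describe the segment between a and b whatever their order. Bounding
    the derivative on that segment only is what yields quadratic remainders when M depends on a and
    b. *)
Lemma mvt_dist (f df : R -> R) (a b M : R) :
  (forall t : R, is_derive t (1:R) f (df t)) ->
  (forall t, `|t - a| <= `|a - b| -> `|t - b| <= `|a - b| -> `|df t| <= M) ->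
  `|f a - f b| <= M * `|a - b|.
Proof.
move=> fd; wlog ab : a b / a < b.
  move=> H; have [ab|ba|->] := ltgtP a b; first exact: H.
    move=> dM; rewrite distrC (distrC a); apply: H => // t ta tb.
    by apply: dM; rewrite (distrC a).
  by rewrite !subrr normr0 mulr0.
have cf : {within `[a, b], continuous f}.
  apply: derivable_within_continuous => t _; by have [] := fd t.
have [c + E] := MVT ab (fun t _ => fd t) cf.
rewrite in_itv/= => /andP[ac cb] dM.
have nab : `|a - b| = b - a by rewrite distrC gtr0_norm ?subr_gt0.
rewrite distrC E normrM (distrC b) ler_wpM2r//.
by apply: dM; rewrite nab ler_norml; apply/andP; split; lra.
Qed.

Lemma cos_dist (a b : R) : `|cos a - cos b| <= `|a - b|.
Proof.
rewrite -[leRHS]mul1r; apply: (@mvt_dist (@cos R) (fun t => - sin t)).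
by move=> t _ _; rewrite normrN; exact: sin_max.
Qed.

Lemma sin_dist (a b : R) : `|sin a - sin b| <= `|a - b|.
Proof.
rewrite -[leRHS]mul1r; apply: (@mvt_dist (@sin R) (@cos R)).
by move=> t _ _; exact: cos_max.
Qed.

Lemma sin_linear_dist (u : R) : `|u - sin u| <= `|u| * `|u|.
Proof.
have D (t : R) : is_derive t (1:R) (fun t => t - sin t) (1 - cos t).
  exact: is_deriveB.
have := @mvt_dist _ _ u 0 `|u| D; rewrite sin0 !subr0; apply.
move=> t _; rewrite subr0 => tu; apply: le_trans tu.
by rewrite -cos0 (le_trans (cos_dist _ _))// sub0r normrN.
Qed.

Lemma cube_scale (d r : R) j : 0 <= d <= r -> cube 0 r (d *: evec R j : V).
Proof.
move=> /andP[d0 dr] i; rewrite !mxE subr0 eqxx /=; case: (i == j).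
  by rewrite mulr1 ger0_norm.
by rewrite mulr0 normr0 (le_trans d0).
Qed.

(* x_j is the C^1 limit of sin (d x_j) / d as d tends to 0. *)
Lemma trig_approx_coord (L : R) j : 0 < L -> trig_approx L (fun x => x 0 j).
Proof.
move=> L0; split=> [|r e r0 e0]; first exact: C1coord.
(* The error is at most d L^2 for the values and d L for the derivatives; L (1 + L) dominates both
   factors. *)
pose d := Num.min r (e / (L * (1 + L))).
have LL : 0 < L * (1 + L) by rewrite mulr_gt0 ?addr_gt0.
have d0 : 0 < d by rewrite /d lt_min r0 divr_gt0.
have dr : d <= r by rewrite /d ge_min lexx.
have de : d * (L * (1 + L)) <= e by rewrite -ler_pdivlMr// /d ge_min lexx orbT.
have deL : d * L <= e.
  by apply: le_trans de; rewrite mulrDr mulr1 mulrDr lerDl; rewrite !mulr_ge0 ?ltW.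
have deLL : d * L * L <= e.
  by apply: le_trans de; rewrite mulrDr mulr1 mulrDr mulrA lerDr; rewrite !mulr_ge0 ?ltW.
exists (fun x => d^-1 * cos (dotp x (d *: evec R j) + - (pi / 2))); split.
  by apply: trig_cos; apply: cube_scale; rewrite dr ltW.
have dn0 : d != 0 by rewrite gt_eqF.
have cosd x : box L x -> `|1 - cos (d * x 0 j)| <= d * L.
  move=> Kx; rewrite -cos0; apply: le_trans (cos_dist _ _) _.
  by rewrite sub0r normrN normrM (gtr0_norm d0) ler_pM2l.
move=> x Kx; split=> [|i].
  rewrite dotpZr dotp_evec cosBpihalf.
  have -> : x 0 j - d^-1 * sin (d * x 0 j) = d^-1 * (d * x 0 j - sin (d * x 0 j)) by field.
  rewrite normrM gtr0_norm ?invr_gt0// mulrC ler_pdivrMr//.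
  apply: le_trans (sin_linear_dist _) _; rewrite normrM (gtr0_norm d0).
  have H : d * `|x 0 j| * (d * `|x 0 j|) <= d * L * L * d.
    rewrite (_ : d * L * L * d = d * L * (d * L)); last by ring.
    by apply: ler_pM; rewrite ?mulr_ge0 ?(ltW d0)// ler_pM2l.
  by apply: le_trans H _; rewrite ler_pM2r.
rewrite partial_coord partialM; [|exact: C1cst|exact: C1cos].
rewrite partialcst partial_cos dotpZr dotp_evec sinBpihalf mulr0 addr0 !mxE eqxx /= eq_sym.
rewrite mulrNN mulrA [d^-1 * _]mulrA mulVf// mul1r -{1}[(i == j)%:R]mulr1 -mulrBr normrM.
apply: le_trans (_ : 1 * (d * L) <= _); last by rewrite mul1r.
by apply: ler_pM => //; [case: (i == j); rewrite ?normr1 ?normr0|exact: cosd].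
Qed.

End trig.

(** * Bernstein approximation in one coordinate *)

Section bernstein.
Context {R : realType}.
Implicit Types (phi psi : nat -> R) (u c : R).

(* The expectation of phi (X) for X binomial with parameters N and u, computed
   by conditioning on one trial: no binomial coefficient is needed. *)
Fixpoint bern N phi u : R :=
  if N is N'.+1 then u * bern N' (fun k => phi k.+1) u + (1 - u) * bern N' phi u
  else phi 0%N.

Lemma bern_le N phi psi u : 0 <= u <= 1 ->
  (forall k, (k <= N)%N -> phi k <= psi k) -> bern N phi u <= bern N psi u.
Proof.
move=> /andP[u0 u1]; elim: N phi psi => [|N IH] phi psi H /=; first exact: H.
apply: lerD; apply: ler_wpM2l; rewrite ?subr_ge0//; apply: IH => k kN; apply: H => //.
exact: leqW.
Qed.

Lemma bern_lin N phi psi u c :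
  bern N (fun k => c * phi k + psi k) u = c * bern N phi u + bern N psi u.
Proof. by elim: N phi psi => [//|N IH] phi psi /=; rewrite !IH; ring. Qed.

Lemma bern_cst N c u : bern N (fun=> c) u = c.
Proof. by elim: N => [//|N IH] /=; rewrite IH; ring. Qed.

Lemma bernZ N c phi u : bern N (fun k => c * phi k) u = c * bern N phi u.
Proof. by elim: N phi => [//|N IH] phi /=; rewrite !IH; ring. Qed.

Lemma bern_dist N phi u c : 0 <= u <= 1 ->
  `|c - bern N phi u| <= bern N (fun k => `|c - phi k|) u.
Proof.
move=> u01.
have -> : c - bern N phi u = bern N (fun k => -1 * phi k + c) u.
  by rewrite bern_lin bern_cst; ring.
rewrite ler_norml -[X in X <= _]mulN1r -bernZ; apply/andP; split; apply: bern_le => // k _.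
  by rewrite !mulN1r addrC lerNl -normrN ler_norm.
by rewrite mulN1r addrC ler_norm.
Qed.

(** Leaving the centre c free makes the induction close, since a success in the first trial replaces
    c by c - 1. At c = N u this is the binomial variance used for Chebyshev's inequality. *)
Lemma bern_variance N u c :
  bern N (fun k => (k%:R - c) ^+ 2) u = (N%:R * u - c) ^+ 2 + N%:R * (u * (1 - u)).
Proof.
elim: N c => [|N IH] c /=; first by ring.
have E := IH (c - 1).
have -> : (fun k => (k.+1%:R - c) ^+ 2) = (fun k : nat => (k%:R - (c - 1)) ^+ 2).
  by apply/funext => k; rewrite -natr1; congr (_ ^+ 2); ring.
by rewrite E IH -natr1; ring.
Qed.

Lemma bern_der (V : normedModType R) N (phi : nat -> V -> R) (dphi : nat -> R)
    (u : V -> R) (du : R) x v :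
  (forall k, is_derive x v (phi k) (dphi k)) -> is_derive x v u du ->
  is_derive x v (fun z => bern N (fun k => phi k z) (u z))
    (bern N dphi (u x) +
     du * (N%:R * bern N.-1 (fun k => phi k.+1 x - phi k x) (u x))).
Proof.
move=> dp du'; elim: N phi dphi dp => [|N IH] phi dphi dp.
  by rewrite mul0r mulr0 addr0; exact: dp.
have D1 := derM du' (IH (fun k => phi k.+1) (fun k => dphi k.+1) (fun k => dp k.+1)).
have D2 := derM (derD (dercst 1 x v) (derN du')) (IH phi dphi dp).
apply: (is_derive_eq (derD D1 D2)).
have L : bern N (fun k => phi k.+1 x - phi k x) (u x) =
  bern N (fun k => phi k.+1 x) (u x) - bern N (fun k => phi k x) (u x).
  rewrite (_ : (fun k => phi k.+1 x - phi k x) = (fun k => -1 * phi k x + phi k.+1 x)).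
    by rewrite bern_lin; ring.
  by apply/funext => k; ring.
(* The induction hypothesis contains [bern N.-1], which has its recursive form only for a successor.
   Afterwards L, unfolded once, is the one relation that is not a ring identity. *)
case: N L {IH D1 D2} => [|N] L; first by rewrite /=; ring.
have -> : N.+1.-1 = N by [].
move: L => /=.
set a := bern N (fun k => phi k.+2 x - _) _; set b := bern N (fun k => phi k.+1 x - _) _.
set A := bern N (fun k => phi k.+2 x) _; set B := bern N (fun k => phi k.+1 x) _.
set C := bern N (fun k => phi k x) _.
set d1 := bern N (fun k => dphi k.+2) _; set d2 := bern N (fun k => dphi k.+1) _.
set d3 := bern N dphi _.
rewrite /= -(natr1 N.+1).
move: N.+1%:R => m L.
rewrite (_ : u x * A + (1 - u x) * B = (u x * a + (1 - u x) * b) + (u x * B + (1 - u x) * C)).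
  by ring.
by rewrite L; ring.
Qed.

End bernstein.

(** * Bernstein approximation in several variables and density of trigonometric sums *)

Section density.
Context {R : realType} {n : nat}.
Local Notation V := 'rV[R]_n.
Implicit Types (f g : V -> R) (x v : V) (phi : nat -> V -> R).

Lemma trig_approx_bern (L : R) N phi (u : V -> R) :
  (forall k, trig_approx L (phi k)) -> trig_approx L u ->
  trig_approx L (fun x => bern N (fun k => phi k x) (u x)).
Proof.
move=> Cp Cu; elim: N phi Cp => [|N IH] phi Cp /=; first exact: Cp.
apply: trig_approxD; apply: trig_approxM => //; [exact: IH| |exact: IH].
apply: trig_approxD; first exact: trig_approx_cst.
have -> : (fun x => - u x) = (fun x => -1 * u x) by apply/funext => x; rewrite mulN1r.
by apply: trig_approxM => //; exact: trig_approx_cst.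
Qed.

Definition put (j : 'I_n) (t : R) x : V := x + (t - x 0 j) *: evec R j.

Lemma putE j t x i : put j t x 0 i = if i == j then t else x 0 i.
Proof.
rewrite /put !mxE eqxx /=; case: eqP => [->|_]; first by rewrite mulr1 addrC subrK.
by rewrite mulr0 addr0.
Qed.

Lemma put_box (L : R) j t x : box L x -> `|t| <= L -> box L (put j t x).
Proof. by move=> Kx tL i; rewrite putE; case: ifP. Qed.

Lemma put_cont j t : continuous (put j t : V -> V).
Proof.
move=> x; rewrite /put; apply: (@continuousD _ _ _ id); first exact: cvg_id.
apply: continuousZr_tmp; apply: (@continuousB _ _ _ (fun=> t)).
  exact: (@cst_continuous V R t x).
exact: coord_cont.
Qed.

Lemma put_shift j t (h : R) x i : i != j ->
  put j t (h *: evec R i + x) = h *: evec R i + put j t x.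
Proof.
move=> ij; apply/rowP => l; rewrite [RHS]mxE !putE !mxE eqxx /=.
case: eqP => [->|//]; by rewrite eq_sym (negPf ij) mulr0 add0r.
Qed.

Lemma put_shift_eq j t (h : R) x : put j t (h *: evec R j + x) = put j t x.
Proof.
apply/rowP => l; rewrite !putE !mxE eqxx /=.
by case: eqP => [//|_]; rewrite mulr0 add0r.
Qed.

Lemma put_add j (h t : R) x : put j (h + t) x = h *: evec R j + put j t x.
Proof.
apply/rowP => l; rewrite [RHS]mxE !putE !mxE eqxx /=.
by case: eqP => [//|_]; rewrite ?mulr1 ?mulr0 ?add0r.
Qed.

Lemma put_der f j t x i : C1on setT f ->
  is_derive x (evec R i) (fun z => f (put j t z))
    (if i == j then 0 else partial f i (put j t x)).
Proof.
move=> Cf; apply/is_derive_line; case: ifPn => [/eqP ->|ij].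
  under eq_fun do rewrite put_shift_eq.
  exact: dercst.
under eq_fun do rewrite put_shift//.
by have /is_derive_line := C1_der Cf (put j t x) i.
Qed.

Lemma C1_put f j t : C1on setT f -> C1on setT (fun z => f (put j t z)).
Proof.
move=> Cf; apply: (@C1_intro _ _ _ (fun i x => if i == j then 0 else partial f i (put j t x))).
- move=> x; apply: continuous_comp; first exact: put_cont.
  by apply: C1_cont.
- by move=> x i; exact: put_der.
- move=> i; case: (i == j); first exact: contcst.
  move=> x; apply: (@continuous_comp _ _ _ (put j t) (partial f i)); first exact: put_cont.
  by apply: C1_dcont.
Qed.

Lemma put_line f j t x : C1on setT f ->
  is_derive (t : R) (1 : R) (fun s => f (put j s x)) (partial f j (put j t x)).
Proof.
move=> Cf; have := C1_der Cf (put j t x) j.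
have E : (fun h : R => h^-1 *: (((fun s => f (put j s x)) \o shift t) (h *: 1) -
    (fun s => f (put j s x)) t)) =
  (fun h : R => h^-1 *: ((f \o shift (put j t x)) (h *: evec R j) - f (put j t x))).
  by apply/funext => h /=; rewrite put_add /GRing.scale /= mulr1.
by move=> -[H1 H2]; split; move: H1 H2; rewrite /derivable /derive E.
Qed.

(** Chebyshev's argument with nodes that may be off the regular grid by one step h. The slack is
    needed for derivatives, whose nodes are intermediate points supplied by the mean value
    theorem. *)
Lemma bern_approx f j (L e : R) : continuous f -> 0 < L -> 0 < e ->
  exists M0, forall M (h : R) x (eta : nat -> R), (M0 <= M)%N -> (0 < M)%N ->
    M%:R * h = 2 * L -> box L x ->
    (forall k, (k <= M)%N -> `|eta k| <= L /\ `|eta k - (h * k%:R - L)| <= h) ->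
    `|f x - bern M (fun k => f (put j (eta k) x)) ((x 0 j + L) / (2 * L))| <= e.
Proof.
move=> cf L0 e0; have e2 : 0 < e / 2 by lra.
have [d [d0 Hd]] := box_unif L cf e2; have [C [C0 HC]] := box_bounded L cf.
(* Chosen so that M >= A0 makes 2 A M = 32 C L^2 / (d^2 M) at most e / 2, with A below and h = 2 L /
   M. *)
pose A0 := 64 * C * L ^+ 2 / d ^+ 2 / e.
have A0p : 0 <= A0 by rewrite !mulr_ge0 ?invr_ge0 ?exprn_ge0// ltW.
exists (Num.truncn A0).+1 => M h x eta M0M Mp Mh Kx Heta.
have MA : A0 <= M%:R.
  by apply: le_trans (ltW (truncnS_gt A0)) _; rewrite ler_nat.
have MR : 0 < M%:R :> R by rewrite ltr0n.
have h0 : 0 < h by rewrite -(pmulr_rgt0 _ MR) Mh; lra.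
have LL : 0 < 2 * L by lra.
set u := (x 0 j + L) / (2 * L).
have u01 : 0 <= u <= 1.
  have := Kx j; rewrite ler_norml => /andP[? ?].
  by rewrite /u divr_ge0 ?ler_pdivrMr ?mul1r; [|lra..]; lra.
have hMu : h * (M%:R * u) = x 0 j + L.
  by rewrite mulrA (mulrC h) Mh /u mulrC divfK// gt_eqF.
apply: le_trans (bern_dist _ _ _ u01) _.
(* At nodes at distance at least d from x_j, the difference is at most 2 C, hence at most 2 C (x_j -
   eta_k)^2 / d^2, and (x_j - eta_k)^2 <= 2 h^2 ((k - M u)^2 + 1), the 1 paying for the displacement
   of the node. *)
pose A := 4 * C / d ^+ 2 * h ^+ 2.
have A_ge0 : 0 <= A by rewrite !mulr_ge0 ?invr_ge0 ?exprn_ge0// ltW.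
have pt k : (k <= M)%N -> `|f x - f (put j (eta k) x)| <=
    A * (k%:R - M%:R * u) ^+ 2 + (e / 2 + A).
  move=> kM; have [eL eh] := Heta k kM.
  have [dk|dk] := ltP `|x 0 j - eta k| d.
    have : `|f x - f (put j (eta k) x)| < e / 2.
      apply: Hd => // i; rewrite putE; case: eqP => [->//|_]; by rewrite subrr normr0.
    by have := mulr_ge0 A_ge0 (sqr_ge0 (k%:R - M%:R * u)); lra.
  have H1 : `|f x - f (put j (eta k) x)| <= 2 * C.
    apply: le_trans (ler_normB _ _) _.
    by have := HC _ Kx; have := HC _ (put_box j Kx eL); lra.
  have H2 : (x 0 j - eta k) ^+ 2 <= 2 * h ^+ 2 * ((k%:R - M%:R * u) ^+ 2 + 1).
    have -> : x 0 j - eta k = - h * (k%:R - M%:R * u) - (eta k - (h * k%:R - L)).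
      by rewrite mulrBr !mulNr opprK hMu; ring.
    move: eh; set b := eta k - _; set a := k%:R - _ => eh.
    have b2 : b ^+ 2 <= h ^+ 2.
      by rewrite -real_normK ?num_real// ler_sqr ?nnegrE// ltW.
    by have := sqr_ge0 (- h * a + b); nra.
  have d2 : d ^+ 2 <= (x 0 j - eta k) ^+ 2.
    by rewrite -[leRHS]real_normK ?num_real// ler_sqr ?nnegrE// ltW.
  have d2p : 0 < d ^+ 2 by rewrite exprn_gt0.
  have H3 : 2 * C <= A * (k%:R - M%:R * u) ^+ 2 + A.
    have -> : A * (k%:R - M%:R * u) ^+ 2 + A =
      2 * C * (2 * h ^+ 2 * ((k%:R - M%:R * u) ^+ 2 + 1)) / d ^+ 2.
      by rewrite /A; ring.
    rewrite ler_pdivlMr//; apply: ler_wpM2l; first lra.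
    exact: le_trans H2.
  by lra.
apply: le_trans (bern_le u01 pt) _; rewrite bern_lin bern_cst bern_variance subrr expr0n /=.
have uu : u * (1 - u) <= 1.
  by move: u01 => /andP[? ?]; nra.
have M1 : 1 <= M%:R :> R by rewrite ler1n.
have Auu : A * (M%:R * (u * (1 - u))) <= A * M%:R.
  by rewrite ler_wpM2l// -[leRHS]mulr1 ler_wpM2l ?ler0n.
have AM : A <= A * M%:R by rewrite -[leLHS]mulr1 ler_wpM2l.
suff : 2 * (A * M%:R) <= e / 2 by rewrite add0r; lra.
have hE : h = 2 * L / M%:R by rewrite -Mh mulrC mulKf// gt_eqF.
have -> : 2 * (A * M%:R) = 32 * C * L ^+ 2 / d ^+ 2 / M%:R.
  by rewrite /A hE; field; rewrite !gt_eqF.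
rewrite ler_pdivrMr//; move: MA; rewrite /A0 ler_pdivrMr//.
by rewrite (_ : 64 * C * L ^+ 2 / d ^+ 2 = 2 * (32 * C * L ^+ 2 / d ^+ 2)); [lra|ring].
Qed.

Definition depends_lt k f :=
  forall x y : V, (forall i : 'I_n, (i < k)%N -> x 0 i = y 0 i) -> f x = f y.

(** Induction on the number of leading coordinates that matter: interpolating in the last of them
    leaves as coefficients [f] frozen at the nodes, which depend on the earlier coordinates only. *)
Lemma C1_trig_approx_depends (L : R) k f : 0 < L -> (k <= n)%N ->
  C1on setT f -> depends_lt k f -> trig_approx L f.
Proof.
move=> L0; elim: k f => [|k IH] f kn Cf df.
  have -> : f = (fun=> f 0) by apply/funext => x; exact: df.
  exact: trig_approx_cst.
pose j := Ordinal kn.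
have LL : 2 * L != 0 by rewrite gt_eqF//; lra.
pose u x : R := (x 0 j + L) / (2 * L).
have Tu : trig_approx L u.
  apply: trig_approxM; last exact: trig_approx_cst.
  by apply: trig_approxD; [exact: trig_approx_coord|exact: trig_approx_cst].
have u' x i : is_derive x (evec R i) u ((i == j)%:R / (2 * L)).
  apply: (is_derive_eq (derM (derD (coord_der j x (evec R i))
    (dercst L x (evec R i))) (dercst (2 * L)^-1 x (evec R i)))).
  by rewrite mulr0 add0r addr0 evecE eq_sym mulrC.
apply: trig_approx_lim => // e e0.
have [Mf HMf] := bern_approx j (C1_cont Cf) L0 e0.
have /choice[Md HMd] : forall l, exists M0, forall M (h : R) x (eta : nat -> R),
    (M0 <= M)%N -> (0 < M)%N -> M%:R * h = 2 * L -> box L x ->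
    (forall k, (k <= M)%N -> `|eta k| <= L /\ `|eta k - (h * k%:R - L)| <= h) ->
    `|partial f l x - bern M (fun k => partial f l (put j (eta k) x)) ((x 0 j + L) / (2 * L))| <= e.
  by move=> l; apply: bern_approx => //; apply: C1_dcont.
(* N trials serve the values and the partial derivatives in the other directions; the derivative in
   direction j loses one trial and is a mean over M. *)
pose M := (Mf + \sum_l Md l).+1; pose N := M.+1.
have MfM : (Mf <= M)%N by rewrite /M -addnS leq_addr.
have MdM l : (Md l <= M)%N.
  by apply: leqW; apply: leq_trans (leq_addl _ _); rewrite (bigD1 l)//= leq_addr.
pose h : R := 2 * L / N%:R; pose h' : R := 2 * L / M%:R.
have Nh : N%:R * h = 2 * L by rewrite mulrC divfK// pnatr_eq0.
have Mh' : M%:R * h' = 2 * L by rewrite mulrC divfK// pnatr_eq0.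
have h0 : 0 < h by rewrite divr_gt0 ?ltr0n//; lra.
have h'0 : 0 < h' by rewrite divr_gt0 ?ltr0n//; lra.
pose t (i : nat) : R := h * i%:R - L.
have tN i : (i <= N)%N -> - L <= t i <= L.
  move=> iN; have iR : i%:R <= N%:R :> R by rewrite ler_nat.
  have i0 : 0 <= i%:R :> R by rewrite ler0n.
  by rewrite /t; apply/andP; split; nra.
have tnorm i : (i <= N)%N -> `|t i| <= L by rewrite ler_norml; exact: tN.
pose phi (i : nat) x := f (put j (t i) x).
have Cphi i : C1on setT (phi i) by exact: C1_put.
exists (fun x => bern N (fun i => phi i x) (u x)); split.
  apply: trig_approx_bern => // i; apply: IH => //; first exact: ltnW.
  move=> x y xy; apply: df => l; rewrite ltnS leq_eqVlt => /orP[/eqP lk|lk].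
    by rewrite !putE; have -> : l == j by apply/eqP/val_inj.
  by rewrite !putE; case: ifP => // _; exact: xy.
move=> x Kx; split.
  apply: (HMf N h) => //; first exact: leqW.
  by move=> i iN; split; [exact: tnorm|rewrite subrr normr0 ltW].
move=> l.
have := @bern_der R V N phi _ u _ x (evec R l) (fun i => put_der j (t i) x l Cf) (u' x l).
move/partialE => ->.
have [->|lj] := eqVneq l j; last first.
  rewrite mul0r mul0r addr0.
  apply: (HMd l N h) => //; first exact: leqW.
  by move=> i iN; split; [exact: tnorm|rewrite subrr normr0 ltW].
rewrite bern_cst add0r.
(* The mean value theorem turns each forward difference into h times a partial derivative at an
   intermediate node, and the factor N h = 2 L cancels the derivative of [u]. *)
have /choice[eta Heta] : forall i, exists s, t i < s < t i.+1 /\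
    phi i.+1 x - phi i x = h * partial f j (put j s x).
  move=> i; have tt : t i < t i.+1 by rewrite /t -natr1; lra.
  have cF : {within `[t i, t i.+1], continuous (fun s => f (put j s x))}.
    by apply: derivable_within_continuous => s _; have [] := put_line j s x Cf.
  have [s si E] := MVT tt (fun s _ => put_line j s x Cf) cF.
  exists s; split; first by move: si; rewrite in_itv.
  by rewrite /phi E mulrC; congr (_ * _); rewrite /t -natr1; ring.
have -> : (fun i => phi i.+1 x - phi i x) = (fun i => h * partial f j (put j (eta i) x)).
  by apply/funext => i; case: (Heta i).
rewrite bernZ mul1r (mulrA N%:R) Nh mulKf//.
apply: (HMd j M h') => // i iM.
have [/andP[e1 e2] _] := Heta i.
have /andP[t1 _] := tN i (leqW iM); have /andP[_ t2] := tN i.+1 iM.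
have iR : i%:R <= M%:R :> R by rewrite ler_nat.
have i0 : 0 <= i%:R :> R by rewrite ler0n.
(* The intermediate nodes follow the grid of step h, while the estimate with M trials refers to step
   h'. Over M steps the two grids drift apart by exactly h, so the nodes stay within h, hence h', of
   the second grid. *)
have NM : M%:R * (h' - h) = h.
  by rewrite mulrBr Mh' -Nh /N -natr1; ring.
have hh : 0 < h' - h by rewrite -(pmulr_rgt0 _ (_ : 0 < M%:R)) ?NM// ltr0n.
have hi : (h' - h) * i%:R <= M%:R * (h' - h) by rewrite mulrC ler_wpM2r// ltW.
rewrite NM in hi.
have hi0 : 0 <= (h' - h) * i%:R by rewrite mulr_ge0// ltW.
split; first by rewrite ler_norml; apply/andP; split; lra.
move: e1 e2; rewrite /t -natr1 => e1 e2.
by rewrite ler_norml; apply/andP; split; nra.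
Qed.

Lemma C1_trig_approx (L : R) f : 0 < L -> C1on setT f -> trig_approx L f.
Proof.
move=> L0 Cf; apply: (@C1_trig_approx_depends L n) => // x y xy; congr f.
by apply/rowP => i; exact: xy.
Qed.

(* f = (f cos) cos + (f sin) sin with cos, sin evaluated at <x, y>: the small
   frequencies approximating f cos and f sin are thereby shifted to y. *)
Lemma trig_dense (L : R) f y (r e : R) : 0 < L -> C1on setT f -> 0 < r -> 0 < e ->
  exists g, trig (cube y r) g /\ clo L f g e.
Proof.
move=> L0 Cf r0 e0; have e2 : 0 < e / 2 by lra.
pose w b x : R := cos (dotp x y + b).
have Cw b : C1on setT (w b) by exact: C1cos.
have [_ A1] : trig_approx L (fun x => f x * w 0 x).
  exact: (C1_trig_approx L0 (C1M Cf (Cw _))).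
have [_ A2] : trig_approx L (fun x => f x * w (- (pi / 2)) x).
  exact: (C1_trig_approx L0 (C1M Cf (Cw _))).
have wT b : trig (cube y 0) (w b).
  rewrite (_ : w b = fun x => 1 * cos (dotp x y + b)).
    by apply: trig_cos => j; rewrite subrr normr0.
  by apply/funext => x; rewrite mul1r.
have fE : f = (fun x => f x * w 0 x * w 0 x + f x * w (- (pi / 2)) x * w (- (pi / 2)) x).
  apply/funext => x; rewrite /w addr0 cosBpihalf -!mulrA -mulrDr -!expr2.
  by rewrite cos2Dsin2 mulr1.
have C2 b : C1on setT (fun x => f x * w b x) := C1M Cf (Cw b).
have step b : (forall r e : R, 0 < r -> 0 < e ->
    exists g, trig (cube 0 r) g /\ clo L (fun x => f x * w b x) g e) ->
  exists g, trig (cube y r) g /\ clo L (fun x => f x * w b x * w b x) g (e / 2).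
  move=> A; have [d [d0 Hd]] := clo_mul L (C2 b) (Cw b) e2.
  have [g [tg cg]] := A _ _ r0 d0.
  exists (fun x => g x * w b x); split; first by apply: trig_mul_cube tg (wT b); rewrite addr0.
  apply: (Hd _ _ (trig_C1 tg) (Cw b) cg).
  by move=> x _; split=> [|j]; rewrite subrr normr0 ltW.
have [g1 [t1 c1]] := step _ A1; have [g2 [t2 c2]] := step _ A2.
exists (fun x => g1 x + g2 x); split; first exact: trig_add.
rewrite {1}fE [e]splitr.
exact: (clo_add (C1_derivable (C1M (C2 _) (Cw _))) (C1_derivable (trig_C1 t1))
  (C1_derivable (C1M (C2 _) (Cw _))) (C1_derivable (trig_C1 t2)) c1 c2).
Qed.

End density.

(** * Extension of a C^1 function from a neighbourhood of a compact set *)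

Section extension.
Context {R : realType} {n : nat}.
Local Notation V := 'rV[R]_n.
Implicit Types (f g : V -> R) (U B K : set V).

(** Used for the truncated square at its kink, and for integrals depending on a parameter, where the
    remainder bound replaces a theorem on differentiation under the integral sign. *)
Lemma is_derive_quadratic (f : R -> R) (t d C : R) :
  (forall h, `|f (h + t) - f t - d * h| <= C * h ^+ 2) -> is_derive t (1:R) f d.
Proof.
move=> H.
have E : h^-1 *: ((f \o shift t) (h *: (1:R)) - f t) @[h --> (0:R)^'] --> d.
  apply/cvgrPdist_le => e e0.
  have C0 : 0 < `|C| + 1 by rewrite ltr_wpDl.
  have eC : 0 < e / (`|C| + 1) by rewrite divr_gt0.
  near=> h.
  have h0 : h != 0 by near: h; exact: nbhs_dnbhs_neq.
  have he : `|h| <= e / (`|C| + 1).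
    near: h; apply: nbhs_dnbhs; apply/nbhs_ballP; exists (e / (`|C| + 1)); [exact: eC|move=> h].
    by rewrite /ball/= sub0r normrN => /ltW.
  rewrite /= /GRing.scale/= mulr1 distrC.
  have -> : h^-1 * (f (h + t) - f t) - d = h^-1 * (f (h + t) - f t - d * h) by field.
  rewrite normrM normfV mulrC ler_pdivrMr ?normr_gt0//.
  apply: le_trans (H h) _.
  rewrite -[h ^+ 2]real_normK ?num_real// expr2 mulrA ler_wpM2r//.
  move: he; rewrite ler_pdivlMr// mulrC; apply: le_trans.
  by rewrite ler_wpM2r// (le_trans (ler_norm C))// lerDl.
split; first by apply/cvg_ex; exists d.
exact: (cvg_lim (@Rhausdorff R) E).
Unshelve. all: by end_near. Qed.

(** The square makes the positive part C^1, with derivative t + |t|; this is all the smoothness that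
    the cutoff functions need. *)
Definition sqpos (t : R) : R := Num.max 0 t ^+ 2.

Lemma sqpos_der (t : R) : is_derive t (1:R) sqpos (t + `|t|).
Proof.
apply: (@is_derive_quadratic _ _ _ 1) => h; rewrite /sqpos mul1r.
case: (leP 0 (h + t)) => a; case: (ger0P t) => b; rewrite ?(max_r b) ?(max_l (ltW b));
  by rewrite ler_norml; apply/andP; split; nra.
Qed.

Lemma sqpos_cont : continuous sqpos.
Proof.
move=> t; have [d _] := sqpos_der t.
exact/differentiable_continuous/derivable1_diffP.
Qed.

Lemma addr_norm_cont : continuous (fun t : R => t + `|t|).
Proof. by move=> t; exact: (cvgD (@cvg_id _ _) (@norm_continuous _ _ t)). Qed.

Lemma C1_sqpos f : C1on setT f -> C1on setT (fun x => sqpos (f x)).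
Proof. exact: (C1comp sqpos_cont addr_norm_cont sqpos_der). Qed.

Lemma sqpos_ge0 t : 0 <= sqpos t. Proof. exact: sqr_ge0. Qed.
Lemma sqpos_gt0 t : (0 < sqpos t) = (0 < t).
Proof.
rewrite /sqpos; case: (leP 0 t) => [t0|t0].
  by rewrite !lt0r sqrf_eq0 sqr_ge0 t0.
by rewrite expr0n/= ltxx; apply/esym/negbTE; rewrite -leNgt ltW.
Qed.
Lemma sqpos_eq0 t : t <= 0 -> sqpos t = 0.
Proof. by move=> t0; rewrite /sqpos max_l// expr0n. Qed.

Lemma C1prod (I : Type) (s : seq I) (F : I -> V -> R) :
  (forall i, C1on setT (F i)) -> C1on setT (fun x => \prod_(i <- s) F i x).
Proof.
move=> CF; elim: s => [|i s IH].
  by under eq_fun do rewrite big_nil; exact: C1cst.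
by under eq_fun do rewrite big_cons; apply: C1M.
Qed.

Lemma C1sum (I : Type) (s : seq I) (F : I -> V -> R) :
  (forall i, C1on setT (F i)) -> C1on setT (fun x => \sum_(i <- s) F i x).
Proof.
move=> CF; elim: s => [|i s IH].
  by under eq_fun do rewrite big_nil; exact: C1cst.
by under eq_fun do rewrite big_cons; apply: C1D.
Qed.

Definition bump (r : R) (a x : V) : R :=
  \prod_j sqpos (r ^+ 2 - (x 0 j - a 0 j) ^+ 2).

Lemma C1_affine_opp f (c : R) : C1on setT f -> C1on setT (fun x => c - f x).
Proof.
move=> Cf; rewrite (_ : (fun x => c - f x) = (fun x => c + -1 * f x)).
  by apply: C1D; [exact: C1cst|apply: C1M => //; exact: C1cst].
by apply/funext => x; rewrite mulN1r.
Qed.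

Lemma C1_bump r a : C1on setT (bump r a).
Proof.
apply: C1prod => j; apply: C1_sqpos; apply: C1_affine_opp.
have C : C1on setT (fun x : V => x 0 j - a 0 j).
  by apply: C1D; [exact: C1coord|exact: C1cst].
by under eq_fun do rewrite expr2; exact: C1M.
Qed.

Lemma bump_ge0 r a x : 0 <= bump r a x.
Proof. by apply: prodr_ge0 => j _; exact: sqpos_ge0. Qed.

Lemma bump_gt0 (r : R) a x : 0 < r -> ball a r x -> 0 < bump r a x.
Proof.
move=> r0 /(rV_ballP _ _ r0) xa; apply: prodr_gt0 => j _.
rewrite sqpos_gt0 subr_gt0 -real_normK ?num_real// distrC.
by rewrite ltr_sqr ?nnegrE// ltW.
Qed.

Lemma bump_eq0 (r : R) a x : 0 < r -> ~ ball a r x -> bump r a x = 0.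
Proof.
move=> r0 xa; have /existsNP[j /negP xj] : ~ forall j, `|a 0 j - x 0 j| < r.
  by move=> /(rV_ballP _ _ r0).
rewrite /bump (bigD1 j)//= sqpos_eq0 ?mul0r// subr_le0 -[leRHS]real_normK ?num_real//.
by rewrite distrC ler_sqr ?nnegrE// ?(ltW r0)// leNgt.
Qed.

(** The vanishing set W is open and contains the complement of U, so a product of [chi] with a
    function that is C^1 only on U is locally zero at every point outside U, hence C^1
    everywhere. *)
Lemma cutoff K U : compact K -> open U -> K `<=` U ->
  exists (chi : V -> R) W, [/\ C1on setT chi, forall x, K x -> chi x = 1,
    open W, U `|` W = setT & forall x, W x -> chi x = 0].
Proof.
move=> cK oU KU.
(* One d is the radius of the bumps, the other the radius of the balls forming W: a point within d
   of the complement of U then meets no bump centred in K. *)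
have [d [d0 Hd]] : exists d : R, 0 < d /\ forall x y, K x -> ball x (d + d) y -> U y.
  have /compact_near_coveringP nc := cK.
  have H : \forall d \near (0:R)^'+, K `<=` [set x : V | forall y : V, ball x (d + d) y -> U y].
    apply: nc => x /KU Ux.
    have /nbhs_ballP[r /= r0 Hr] : nbhs x U by exact: open_nbhs_nbhs.
    have r2 : 0 < r / 2 by rewrite divr_gt0.
    have r4 : 0 < r / 4 by rewrite divr_gt0.
    exists (ball x (r / 2), [set t | t < r / 4]).
      by split; [exact: nbhsx_ballx|exact: nbhs_right_lt].
    case=> x' t [/= xx' tr] y xy; apply: Hr.
    have := ball_triangle xx' xy; apply: le_ball; lra.
  have [d [dp Hd]] := filter_ex (filterI (nbhs_right_gt (0:R)) H).
  by exists d; split => // x y Kx; exact: Hd.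
have := cK; rewrite compact_cover => /(_ V K (fun a => ball a d)).
case.
- by move=> a _; exact: ball_open.
- by move=> x Kx; exists x => //; exact: ballxx.
move=> D DK cov.
pose sigma x : R := \sum_(a <- D) bump d a x.
have Cs : C1on setT sigma by apply: C1sum => a; exact: C1_bump.
have sig0 x : K x -> 0 < sigma x.
  move=> /cov[a aD xa]; rewrite /sigma (big_rem a)//=.
  apply: ltr_wpDr; last exact: bump_gt0.
  by apply: sumr_ge0 => b _; exact: bump_ge0.
have [c [c0 Hc]] : exists c : R, 0 < c /\ forall x, K x -> c <= sigma x.
  have [[x0 Kx0]|K0] := pselect (K !=set0); last first.
    by exists 1; split=> // x Kx; case: K0; exists x.
  have [x Kx Hx] := @EVT_min_rV _ _ sigma K (ex_intro _ x0 Kx0) cK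
     (continuous_subspaceT (C1_cont Cs)).
  exists (sigma x); split; first by apply: sig0; exact: set_mem.
  by move=> y Ky; apply: Hx; exact: mem_set.
(* Where sigma >= c the truncated square is 0 and the value is 1; where sigma = 0 the square is 1
   and the value is 0. *)
exists (fun x => 1 - sqpos (1 - sigma x * c^-1)), (\bigcup_(x in ~` U) ball x d); split.
- by do 2!(apply: C1_affine_opp; try apply: C1_sqpos); apply: C1M => //; exact: C1cst.
- move=> x Kx; rewrite sqpos_eq0 ?subr0// subr_le0 ler_pdivlMr// mul1r; exact: Hc.
- by apply: bigcup_open => x _; exact: ball_open.
- rewrite -subTset => x _; have [Ux|Ux] := pselect (U x); first by left.
  by right; exists x => //; exact: ballxx.
- move=> x [y Uy yx].
  have -> : sigma x = 0.
    rewrite /sigma big_seq big1// => a aD; apply: bump_eq0 => // ax.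
    by apply: Uy; apply: (Hd a); [exact: set_mem (DK _ aD)|exact: ball_triangle ax (ball_sym yx)].
  by rewrite mul0r subr0 /sqpos max_r// expr1n subrr.
Qed.

Lemma C1on_eq U f g : open U -> (forall x, U x -> f x = g x) -> C1on U f -> C1on U g.
Proof.
move=> oU fg Cf x Ux; have [cf [df cdf]] := Cf x Ux.
have nU : nbhs x U by exact: open_nbhs_nbhs.
have near_fg z : U z -> \forall y \near z, f y = g y.
  by move=> Uz; apply: (filterS fg); exact: open_nbhs_nbhs.
have pfg j z : U z -> partial f j z = partial g j z.
  by move=> Uz; apply: near_eq_derive => //; exact: near_fg.
split; [|split].
- rewrite /prop_for /continuous_at -(fg x Ux); apply: cvg_trans cf.
  exact: near_eq_cvg (near_fg x Ux).
- move=> j; apply: near_eq_derivable (df j) => //; exact: near_fg.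
- move=> j; rewrite /prop_for /continuous_at -(pfg j x Ux); apply: cvg_trans (cdf j).
  have npfg : \forall y \near x, partial f j y = partial g j y.
    by move: nU; apply: filterS => y; exact: pfg.
  exact: near_eq_cvg npfg.
Qed.

Lemma C1onM U f g : open U -> C1on U f -> C1on U g -> C1on U (fun x => f x * g x).
Proof.
move=> oU Cf Cg x Ux; have [cf [df cdf]] := Cf x Ux; have [cg [dg cdg]] := Cg x Ux.
have nU : nbhs x U by exact: open_nbhs_nbhs.
have der z j : U z -> is_derive z (evec R j) (fun x => f x * g x)
    (f z * partial g j z + g z * partial f j z).
  move=> Uz; have [_ [/(_ j)/derivableP d1 _]] := Cf z Uz.
  by have [_ [/(_ j)/derivableP d2 _]] := Cg z Uz; exact: derM.
split; [exact: continuousM|split => j; first by have [] := der x j Ux].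
rewrite /prop_for /continuous_at (partialE (der x j Ux)).
have ndf : \forall y \near x, f y * partial g j y + g y * partial f j y =
    partial (fun x => f x * g x) j y.
  by move: nU; apply: filterS => y Uy; rewrite (partialE (der y j Uy)).
have lim : (fun y => f y * partial g j y + g y * partial f j y) @ x -->
    f x * partial g j x + g x * partial f j x.
  exact: (cvgD (cvgM cf (cdg j)) (cvgM cg (cdf j))).
by apply: cvg_trans lim; exact: near_eq_cvg ndf.
Qed.

Lemma C1on_sub U W f : U `<=` W -> C1on W f -> C1on U f.
Proof. by move=> UW Cf x /UW; exact: Cf. Qed.

Lemma bounded_closure B : bounded_set B -> bounded_set (closure B).
Proof.
move=> [M0 [M0r H]]; exists M0; split=> // M /H BM.
have cM : closed [set x : V | `|x| <= M].
  exact: (preimage_closed (fun x _ => @norm_continuous _ _ x) (@closed_le R M)).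
have /closure_id EM := cM.
by move=> x /(closureS BM); rewrite -EM.
Qed.

Lemma C1_extension B U G : bounded_set B -> open B -> open U -> closure B `<=` U ->
  C1on U G -> exists g, C1on setT g /\
    forall x, B x -> g x = G x /\ forall j, partial g j x = partial G j x.
Proof.
move=> bB oB oU BU CG.
have cK : compact (closure B).
  by apply: bounded_closed_compact; [exact: bounded_closure|exact: closed_closure].
have [chi [W [Cchi chi1 oW UW chi0]]] := cutoff cK oU BU.
exists (fun x => chi x * G x); split.
  rewrite -UW => x [Ux|Wx].
    exact: (C1onM oU (C1on_sub (@subsetT _ U) Cchi) CG).
  apply: (@C1on_eq W (fun=> 0)) => //; last exact: C1on_sub (@subsetT _ W) (C1cst 0).
  by move=> y Wy; rewrite chi0// mul0r.
have E x : B x -> chi x * G x = G x by move=> /subset_closure Bx; rewrite chi1// mul1r.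
move=> x Bx; split; first exact: E.
move=> j; apply: near_eq_derive.
by apply: (filterS E); exact: open_nbhs_nbhs.
Qed.

End extension.

(** * Symmetry of a spectral measure with real Fourier transform *)

Section real_integrals.
Context {R : realType} d (T : measurableType d) (mu : {measure set T -> \bar R}).
Implicit Types (f g b : T -> R).

Definition itg f := mu.-integrable setT (EFin \o f).

Definition bounded_real b := exists M : R, forall t, `|b t| <= M.

Lemma itgM f b : itg f -> measurable_fun setT b -> bounded_real b ->
  itg (fun t => f t * b t).
Proof.
move=> itf mb [M bM].
have : mu.-integrable setT ((EFin \o f) \* (EFin \o b))%E.
  apply: integrableMl => //; exists M; split; first exact: num_real.
  by move=> M' MM' t _; apply: le_trans (bM t) (ltW MM').
by apply: eq_integrable.
Qed.

Lemma itgD f g : itg f -> itg g -> itg (fun t => f t + g t).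
Proof.
by move=> itf itg_; have := integrableD measurableT itf itg_; exact: eq_integrable.
Qed.

Lemma itgZ (c : R) f : itg f -> itg (fun t => c * f t).
Proof. by move=> itf; have := integrableZl measurableT c itf; exact: eq_integrable. Qed.

Lemma itgB f g : itg f -> itg g -> itg (fun t => f t - g t).
Proof.
move=> itf itg_; have := itgD itf (itgZ (-1) itg_); apply: eq_integrable => // t _ /=.
by rewrite mulN1r.
Qed.

Lemma itg_sum I (s : seq I) (F : I -> T -> R) : (forall i, itg (F i)) ->
  itg (fun t => \sum_(i <- s) F i t).
Proof.
move=> iF; elim: s => [|i s IH].
  by under eq_fun do rewrite big_nil; exact: integrable0.
by under eq_fun do rewrite big_cons; exact: itgD.
Qed.

Lemma itg_measurable f : itg f -> measurable_fun setT f.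
Proof. by move=> /integrableP[/measurable_EFinP]. Qed.

Lemma RintD f g : itg f -> itg g ->
  Rintegral mu setT (fun t => f t + g t) = Rintegral mu setT f + Rintegral mu setT g.
Proof. exact: RintegralD. Qed.

Lemma RintB f g : itg f -> itg g ->
  Rintegral mu setT (fun t => f t - g t) = Rintegral mu setT f - Rintegral mu setT g.
Proof. exact: RintegralB. Qed.

Lemma RintZ (c : R) f : itg f ->
  Rintegral mu setT (fun t => c * f t) = c * Rintegral mu setT f.
Proof. exact: RintegralZl. Qed.

Lemma Rint_sum I (s : seq I) (F : I -> T -> R) : (forall i, itg (F i)) ->
  Rintegral mu setT (fun t => \sum_(i <- s) F i t) = \sum_(i <- s) Rintegral mu setT (F i).
Proof.
move=> iF; elim: s => [|i s IH].
  rewrite big_nil (_ : (fun t => _) = (fun t => 0 * 0)); last first.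
    by apply/funext => t; rewrite big_nil mul0r.
  by rewrite RintZ ?mul0r//; exact: integrable0.
rewrite big_cons -IH -RintD//; last exact: itg_sum.
by congr (Rintegral _ _ _); apply/funext => t; rewrite big_cons.
Qed.

Lemma Rint_cvg f (b_ : nat -> T -> R) b (M : R) : itg f ->
  (forall k, measurable_fun setT (b_ k)) -> (forall k t, `|b_ k t| <= M) ->
  (forall t, b_ ^~ t @ \oo --> b t) ->
  (fun k => Rintegral mu setT (fun t => f t * b_ k t)) @ \oo -->
    Rintegral mu setT (fun t => f t * b t).
Proof.
move=> itf mb bM bb; have mf := itg_measurable itf.
have mb' : measurable_fun setT b by apply: measurable_fun_cvg mb _ => t _; exact: bb.
have bM' t : `|b t| <= M.
  have bt : (fun k => `|b_ k t|) @ \oo --> `|b t| by apply: cvg_norm; exact: bb.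
  rewrite -(cvg_lim (@Rhausdorff R) bt).
  by apply: limr_le; [exact: cvgP bt|apply: nearW => k; exact: bM].
have itfb : itg (fun t => f t * b t) by apply: itgM => //; exists M.
have [] := @dominated_convergence _ T R mu setT measurableT
  (fun k t => (f t * b_ k t)%:E) (fun t => (f t * b t)%:E) (fun t => (M * `|f t|)%:E).
- by move=> k; apply/measurable_EFinP; exact: measurable_funM.
- by apply/measurable_EFinP; exact: measurable_funM.
- apply: aeW => t _; apply: cvg_EFin; first exact: nearW.
  exact: (cvgM (cvg_cst _) (bb t)).
- exact: itgZ (integrable_norm itf).
- apply: aeW => t k _; rewrite lee_fin normrM mulrC ler_wpM2r//.
move=> _ _ H; apply: fine_cvg.
by rewrite fineK//; apply: integrable_fin_num.
Qed.

End real_integrals.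

(** * Borel measurability on R^n *)

Section borel.
Context {R : realType} {n : nat}.
Local Notation V := 'rV[R]_n.

Lemma open_BRn (U : set V) : open U -> measurable (U : set (BRn R n)).
Proof. by move=> oU; exact: sub_sigma_algebra. Qed.

Lemma cont_BRn (f : V -> R) : continuous f -> measurable_fun setT (f : BRn R n -> R).
Proof.
move=> /continuousP cf; apply: (measurability _ (RGenOpens.measurableE R)).
move=> _ [_ [a [b ->] <-]]; rewrite setTI; apply: open_BRn; apply: cf.
exact: interval_open.
Qed.

Lemma opp_BRn (b : BRn R n -> R) : measurable_fun setT b ->
  measurable_fun setT (fun xi : BRn R n => b (- (xi : V))).
Proof.
move=> mb; have mopp : measurable_fun setT (fun xi : BRn R n => - (xi : V) : BRn R n).
  apply: (@measurability _ _ (BRn R n) (BRn R n) setT _ (@open V)) => //.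
  move=> _ [A oA <-]; rewrite setTI; apply: open_BRn.
  by apply: open_comp oA => x _; exact: opp_continuous.
exact: (measurableT_comp mb mopp).
Qed.

End borel.

(** * Polynomials converging on [0, 1] to the indicator of s < 1/2 *)

Section step_polynomial.
Context {R : realType}.

Lemma bernoulli_ge (t : R) N : 0 <= t <= 1 -> 1 - N%:R * t <= (1 - t) ^+ N.
Proof.
move=> /andP[t0 t1]; elim: N => [|N IH]; first by rewrite expr0; lra.
rewrite exprS -natr1; have N0 : 0 <= N%:R :> R by rewrite ler0n.
have : (1 - t) * (1 - N%:R * t) <= (1 - t) * (1 - t) ^+ N by rewrite ler_wpM2l// subr_ge0.
by apply: le_trans; nra.
Qed.

Lemma bernoulli_le (t : R) N : 0 <= t <= 1 -> (1 - t) ^+ N * (1 + N%:R * t) <= 1.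
Proof.
move=> /andP[t0 t1]; elim: N => [|N IH]; first by rewrite expr0; lra.
rewrite exprS -natr1; have N0 : 0 <= N%:R :> R by rewrite ler0n.
apply: le_trans IH; rewrite mulrAC -mulrA mulrC mulrAC.
rewrite [leLHS](_ : _ = (1 - t) ^+ N * ((1 - t) * (1 + (N%:R + 1) * t))); last by ring.
by apply: ler_wpM2l; [rewrite exprn_ge0// subr_ge0|nra].
Qed.

(** The exponent times s^(2N) is N (2 s)^(2N), which tends to 0 for s < 1/2 and is at least N for s
    >= 1/2. Bernoulli's inequality and its companion upper bound then give the limits 1 and 0; the
    factor N decides the borderline s = 1/2. *)
Definition step_poly N (s : R) : R := (1 - s ^+ N.*2) ^+ (N * 4 ^ N).

Lemma step_poly01 N (s : R) : 0 <= s <= 1 -> 0 <= step_poly N s <= 1.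
Proof.
move=> /andP[s0 s1]; rewrite /step_poly.
have sN0 : 0 <= s ^+ N.*2 by rewrite exprn_ge0.
have sN1 : s ^+ N.*2 <= 1 by rewrite exprn_ile1.
by rewrite exprn_ge0 ?subr_ge0// exprn_ile1 ?subr_ge0// gerBl.
Qed.

Lemma step_poly_cvg (s : R) : 0 <= s <= 1 ->
  (fun N => step_poly N s) @ \oo --> ((s < 2^-1)%R%:R : R).
Proof.
move=> /andP[s0 s1].
pose x := 2 * s.
have xE N : (N * 4 ^ N)%:R * s ^+ N.*2 = N%:R * x ^+ N.*2.
  rewrite natrM natrX -mulrA; congr (_ * _).
  by rewrite /x exprMn -!muln2 mulnC !exprM; congr (_ ^+ N * _); ring.
have sN01 N : 0 <= s ^+ N.*2 <= 1 by rewrite exprn_ge0//= exprn_ile1.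
have [sh|sh] := ltP s 2^-1.
  have x0 : 0 <= x by rewrite /x; lra.
  have x1 : x < 1 by rewrite /x; lra.
  (* Bernoulli's bound gives N x^N <= K, so N x^(2N) <= K x^N tends to 0. *)
  pose K := (1 - x)^-1.
  have K0 : 0 < K by rewrite invr_gt0; lra.
  have NK N : N%:R * x ^+ N <= K.
    have x01 : 0 <= 1 - x <= 1 by apply/andP; split; lra.
    have := bernoulli_le N x01; rewrite subKr => B.
    have xN0 : 0 <= x ^+ N by rewrite exprn_ge0.
    have : N%:R * x ^+ N * (1 - x) <= 1.
      by apply: le_trans B; rewrite mulrDr mulr1; nra.
    by rewrite /K -ler_pdivlMr ?subr_gt0// mul1r.
  apply: (@squeeze_cvgr _ _ _ _ (fun N => 1 - K * x ^+ N) (fun=> 1)).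
  - apply: nearW => N; have /andP[_ ->] := step_poly01 N (introT andP (conj s0 s1)).
    rewrite andbT; apply: le_trans (bernoulli_ge _ (sN01 N)).
    rewrite xE lerD2l lerN2 -addnn exprD mulrA ler_wpM2r ?exprn_ge0//.
  - rewrite -[X in _ --> X]subr0; apply: cvgB; first exact: cvg_cst.
    rewrite -(mulr0 K); apply: cvgM; first exact: cvg_cst.
    by apply: cvg_expr; rewrite ger0_norm.
  - exact: cvg_cst.
have x1 : 1 <= x by rewrite /x; lra.
apply: (@squeeze_cvgr _ _ _ _ (fun=> 0) (@harmonic R)).
- apply: nearW => N; have /andP[-> _] := step_poly01 N (introT andP (conj s0 s1)).
  rewrite /harmonic /=.
  have := bernoulli_le (N * 4 ^ N) (sN01 N); rewrite xE -/(step_poly N s) => B.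
  rewrite -[leRHS]mul1r ler_pdivlMr ?ltr0n//; apply: le_trans B.
  have /andP[sp0 _] := step_poly01 N (introT andP (conj s0 s1)).
  apply: ler_wpM2l => //; rewrite -natr1 addrC lerD2l -[leLHS]mulr1.
  by rewrite ler_wpM2l ?ler0n// exprn_ege1.
- exact: cvg_cst.
- exact: cvg_harmonic.
Qed.

End step_polynomial.

(** * Multipliers that preserve the symmetry of the spectral measure *)

Section spectral_symmetry.
Context {R : realType} {n : nat} (mu : {measure set (BRn R n) -> \bar R}).
Local Notation V := 'rV[R]_n.
Context (p q : BRn R n -> R) (ip : itg mu p) (iq : itg mu q).
Implicit Types (b phi psi : BRn R n -> R) (x : V) (c : R).

(* The real part of e^{i (c + <x, xi>)} (p + i q). *)
Definition wave c x (xi : BRn R n) : R :=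
  p xi * cos (c + dotp x xi) - q xi * sin (c + dotp x xi).

Definition waveint c x b : R := Rintegral mu setT (fun xi => wave c x xi * b xi).

Definition flip b : BRn R n -> R := fun xi => b (- (xi : V)).

Lemma phase_cont c x : continuous (fun xi : V => c + dotp x xi).
Proof.
apply: contD; first exact: contcst.
have -> : dotp x = (fun xi => dotp xi x) by apply/funext => xi; exact: dotpC.
exact: dotp_cont.
Qed.

Lemma cos_phase c x : measurable_fun setT (fun xi : BRn R n => cos (c + dotp x xi)).
Proof. by apply: cont_BRn; apply: contcomp; [exact: continuous_cos|exact: phase_cont]. Qed.
Lemma sin_phase c x : measurable_fun setT (fun xi : BRn R n => sin (c + dotp x xi)).
Proof. by apply: cont_BRn; apply: contcomp; [exact: continuous_sin|exact: phase_cont]. Qed.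

Lemma bounded_cos (f : BRn R n -> R) : bounded_real (fun xi => cos (f xi)).
Proof. by exists 1 => xi; exact: cos_max. Qed.
Lemma bounded_sin (f : BRn R n -> R) : bounded_real (fun xi => sin (f xi)).
Proof. by exists 1 => xi; exact: sin_max. Qed.

Lemma itg_wave c x : itg mu (wave c x).
Proof.
apply: itgB; apply: itgM => //.
- exact: cos_phase.
- exact: bounded_cos.
- exact: sin_phase.
- exact: bounded_sin.
Qed.

Definition admissible b := measurable_fun setT b /\ bounded_real b.

Lemma admissible_flip b : admissible b -> admissible (flip b).
Proof.
move=> [mb [M bM]]; split; first exact: opp_BRn.
by exists M => xi; exact: bM.
Qed.

Lemma admissibleM b b' : admissible b -> admissible b' -> admissible (fun xi => b xi * b' xi).
Proof.
move=> [mb [M bM]] [mb' [M' bM']]; split; first exact: measurable_funM.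
by exists (M * M') => xi; rewrite normrM; apply: ler_pM.
Qed.

Lemma admissibleD b b' : admissible b -> admissible b' -> admissible (fun xi => b xi + b' xi).
Proof.
move=> [mb [M bM]] [mb' [M' bM']]; split; first exact: measurable_funD.
by exists (M + M') => xi; apply: le_trans (ler_normD _ _) _; apply: lerD.
Qed.

Lemma admissible_cst c : admissible (fun=> c).
Proof. by split; [exact: measurable_cst|exists `|c| => xi]. Qed.

Lemma admissible_cos c x : admissible (fun xi => cos (c + dotp x xi)).
Proof. by split; [exact: cos_phase|exact: bounded_cos]. Qed.

Lemma itg_wave_mul c x b : admissible b -> itg mu (fun xi => wave c x xi * b xi).
Proof. by move=> [mb bb]; apply: itgM => //; exact: itg_wave. Qed.

(** Two complex numbers z, w are conjugate when Re (e^(ic) z) = Re (e^(-ic) w) for all c. The free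
    phase states conjugacy of the two complex integrals by real integrals alone. *)
Definition symmetric psi := forall c x, waveint c x psi = waveint (- c) x (flip psi).

(** Symmetric functions are not visibly closed under products. Quantifying over every symmetric
    [psi] makes closure under products a mere composition. *)
Definition multiplier phi := admissible phi /\
  forall psi, admissible psi -> symmetric psi -> symmetric (fun xi => phi xi * psi xi).

Lemma waveintD c x b b' : admissible b -> admissible b' ->
  waveint c x (fun xi => b xi + b' xi) = waveint c x b + waveint c x b'.
Proof.
move=> ab ab'; rewrite /waveint -RintD; try exact: itg_wave_mul.
by congr (Rintegral _ _ _); apply/funext => xi; rewrite mulrDr.
Qed.

Lemma waveintZ a c x b : admissible b ->
  waveint c x (fun xi => a * b xi) = a * waveint c x b.
Proof.
move=> ab; rewrite /waveint -RintZ; last exact: itg_wave_mul.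
by congr (Rintegral _ _ _); apply/funext => xi; rewrite mulrCA.
Qed.

Lemma multiplier_cst a : multiplier (fun=> a).
Proof.
split=> [|psi apsi spsi c x]; first exact: admissible_cst.
rewrite waveintZ// spsi -waveintZ//; exact: admissible_flip.
Qed.

Lemma multiplierD phi phi' : multiplier phi -> multiplier phi' ->
  multiplier (fun xi => phi xi + phi' xi).
Proof.
move=> [a H] [a' H']; split=> [|psi apsi spsi c x]; first exact: admissibleD.
have E (f g h : BRn R n -> R) : (fun xi => (f xi + g xi) * h xi) = (fun xi => f xi * h xi + g xi * h xi).
  by apply/funext => xi; rewrite mulrDl.
rewrite E waveintD; try exact: admissibleM.
rewrite H// H'// -waveintD; try (apply: admissible_flip; exact: admissibleM).
by congr (waveint _ _ _); apply/funext => xi; rewrite /flip mulrDl.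
Qed.

Lemma multiplierM phi phi' : multiplier phi -> multiplier phi' ->
  multiplier (fun xi => phi xi * phi' xi).
Proof.
move=> [a H] [a' H']; split=> [|psi apsi spsi]; first exact: admissibleM.
have -> : (fun xi => phi xi * phi' xi * psi xi) = (fun xi => phi xi * (phi' xi * psi xi)).
  by apply/funext => xi; rewrite mulrA.
by apply: H; [exact: admissibleM|exact: H'].
Qed.

Lemma multiplierX phi N : multiplier phi -> multiplier (fun xi => phi xi ^+ N).
Proof.
move=> Mphi; elim: N => [|N IH]; first exact: multiplier_cst.
by under eq_fun do rewrite exprS; exact: multiplierM.
Qed.

Lemma wave_cos c x a y xi : cos (a + dotp y xi) * wave c x xi =
  2^-1 * (wave (c + a) (x + y) xi + wave (c - a) (x - y) xi).
Proof.
rewrite /wave !dotpDl dotpNl.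
have -> : c + a + (dotp x xi + dotp y xi) = (c + dotp x xi) + (a + dotp y xi) by ring.
have -> : c - a + (dotp x xi - dotp y xi) = (c + dotp x xi) - (a + dotp y xi) by ring.
move: (c + dotp x xi) (a + dotp y xi) => P Q.
by rewrite cosB cosD sinB sinD; field.
Qed.

Lemma waveint_cos c x a y b : admissible b ->
  waveint c x (fun xi => cos (a + dotp y xi) * b xi) =
  2^-1 * (waveint (c + a) (x + y) b + waveint (c - a) (x - y) b).
Proof.
move=> ab; rewrite /waveint -RintD; try exact: itg_wave_mul.
rewrite -RintZ; last by apply: itgD; exact: itg_wave_mul.
congr (Rintegral _ _ _); apply/funext => xi.
by rewrite mulrCA mulrA wave_cos -mulrDl mulrA.
Qed.

(* Multiplying by a cosine shifts c and x, and symmetric quantifies over both. *)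
Lemma multiplier_cos a y : multiplier (fun xi => cos (a + dotp y xi)).
Proof.
split=> [|psi apsi spsi c x]; first exact: admissible_cos.
rewrite waveint_cos// !spsi.
have -> : flip (fun xi => cos (a + dotp y xi) * psi xi) =
  (fun xi => cos (- a + dotp y xi) * flip psi xi).
  apply/funext => xi; rewrite /flip dotpNr -cosN.
  by congr (cos _ * _); ring.
rewrite waveint_cos; last exact: admissible_flip.
by rewrite opprD opprB opprK (addrC (- c) a).
Qed.

Lemma multiplier_lim (phi_ : nat -> BRn R n -> R) phi (M : R) :
  (forall k, multiplier (phi_ k)) -> (forall k xi, `|phi_ k xi| <= M) ->
  (forall xi, phi_ ^~ xi @ \oo --> phi xi) -> multiplier phi.
Proof.
move=> Mphi bM lim.
have bM' xi : `|phi xi| <= M.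
  have bt : (fun k => `|phi_ k xi|) @ \oo --> `|phi xi| by apply: cvg_norm; exact: lim.
  rewrite -(cvg_lim (@Rhausdorff R) bt).
  by apply: limr_le; [exact: cvgP bt|apply: nearW => k; exact: bM].
have aphi : admissible phi.
  split; last by exists M.
  by apply: (@measurable_fun_cvg _ _ _ setT phi_) => [k|xi _]; [case: (Mphi k) => -[]|exact: lim].
split=> // psi apsi spsi c x.
have C c' x' (b_ : nat -> BRn R n -> R) b (psi' : BRn R n -> R) : admissible psi' ->
    (forall k, admissible (b_ k)) -> (forall k xi, `|b_ k xi| <= M) ->
    (forall xi, b_ ^~ xi @ \oo --> b xi) ->
    (fun k => waveint c' x' (fun xi => b_ k xi * psi' xi)) @ \oo -->
    waveint c' x' (fun xi => b xi * psi' xi).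
  move=> apsi' ab bb bl; rewrite /waveint.
  have E (f : BRn R n -> R) : (fun xi => wave c' x' xi * (f xi * psi' xi)) =
     (fun xi => wave c' x' xi * psi' xi * f xi).
    by apply/funext => xi; rewrite mulrCA mulrC.
  under eq_fun do rewrite E.
  rewrite E; apply: Rint_cvg bb bl; first exact: itg_wave_mul.
  by move=> k; case: (ab k).
have C1 := C c x phi_ phi psi apsi (fun k => proj1 (Mphi k)) bM lim.
have C2 := C (- c) x (fun k => flip (phi_ k)) (flip phi) (flip psi) (admissible_flip apsi)
  (fun k => admissible_flip (proj1 (Mphi k))) (fun k xi => bM k _) (fun xi => lim _).
have E : (fun k => waveint c x (fun xi => phi_ k xi * psi xi)) =
  (fun k => waveint (- c) x (fun xi => flip (phi_ k) xi * flip psi xi)).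
  by apply/funext => k; case: (Mphi k) => _ ->.
rewrite E in C1.
by rewrite -(cvg_lim (@Rhausdorff R) C1) -(cvg_lim (@Rhausdorff R) C2).
Qed.

(** The sign of <y, xi> - a is the sign of sin ((<y, xi> - a) / (k + 1)) once k is large, the
    argument then lying in (-pi, pi). For fixed k, the number s = (1 - sin) / 2 lies in [0, 1], is
    below 1/2 exactly when the sine is positive, and is a multiplier; [step_poly] of it converges to
    the indicator. *)
Lemma multiplier_halfspace y a :
  multiplier (fun xi => (a < dotp y xi)%R%:R).
Proof.
pose s k xi : R := 2^-1 * (1 - sin (k.+1%:R^-1 * (dotp y xi - a))).
have s01 k xi : 0 <= s k xi <= 1.
  rewrite /s; have := sin_le1 (k.+1%:R^-1 * (dotp y xi - a)).
  have := sin_geN1 (k.+1%:R^-1 * (dotp y xi - a)).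
  by move=> ? ?; apply/andP; split; lra.
have Ms k : multiplier (s k).
  have -> : s k = (fun xi => 2^-1 + (- 2^-1) *
      cos ((- (k.+1%:R^-1 * a) - pi / 2) + dotp (k.+1%:R^-1 *: y) xi)).
    apply/funext => xi; rewrite dotpZl.
    rewrite (_ : _ + _ * dotp _ _ = k.+1%:R^-1 * (dotp y xi - a) - pi / 2); last by ring.
    by rewrite cosBpihalf /s; ring.
  apply: multiplierD; first exact: multiplier_cst.
  by apply: multiplierM; [exact: multiplier_cst|exact: multiplier_cos].
have Mstep k : multiplier (fun xi => (s k xi < 2^-1)%R%:R).
  apply: (@multiplier_lim (fun N xi => step_poly N (s k xi)) _ 1).
  - move=> N; rewrite /step_poly; apply: multiplierX.
    rewrite (_ : (fun xi => _) = (fun xi => 1 + (-1) * s k xi ^+ N.*2)).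
      apply: multiplierD; first exact: multiplier_cst.
      by apply: multiplierM; [exact: multiplier_cst|exact: multiplierX].
    by apply/funext => xi; rewrite mulN1r.
  - by move=> N xi; have /andP[a0 a1] := step_poly01 N (s01 k xi); rewrite ger0_norm.
  - by move=> xi; exact: step_poly_cvg.
apply: (@multiplier_lim (fun k xi => (s k xi < 2^-1)%R%:R) _ 1) => //.
  by move=> k xi; case: (_ < _); rewrite ?normr1 ?normr0.
move=> xi; set t := dotp y xi.
apply: cvg_near_cst; near=> k; congr (nat_of_bool _)%:R.
have kt : `|t - a| < k.+1%:R.
  apply: lt_trans (_ : k%:R < _); last by rewrite ltr_nat.
  by near: k; exact: nbhs_infty_gtr.
have k0 : 0 < k.+1%:R^-1 :> R by rewrite invr_gt0 ltr0n.
have pi1 : 1 < pi :> R by apply: lt_le_trans (pi_ge2 R); lra.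
have ut : `|k.+1%:R^-1 * (t - a)| < 1.
  by rewrite normrM gtr0_norm// mulrC ltr_pdivrMr ?ltr0n// mul1r.
rewrite /s -/t.
have [ta|ta|E] := ltgtP a t.
- have : 0 < sin (k.+1%:R^-1 * (t - a)); last by lra.
  apply: sin_gt0_pi; move: ut; rewrite ltr_norml => /andP[_ ut].
  by rewrite mulr_gt0 ?subr_gt0//= (lt_trans ut).
- have : 0 < sin (- (k.+1%:R^-1 * (t - a))); last first.
    by rewrite sinN => ?; apply/negbTE; rewrite -leNgt; lra.
  apply: sin_gt0_pi; move: ut; rewrite ltr_norml => /andP[ut _].
  rewrite -mulrN opprB mulr_gt0 ?subr_gt0//=; apply: lt_trans pi1.
  by rewrite -opprB mulrN ltrNl.
- by rewrite E subrr mulr0 sin0 subr0 mulr1 ltxx.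
Unshelve. all: by end_near. Qed.

Lemma multiplier_prod (I : Type) (s : seq I) (phi : I -> BRn R n -> R) :
  (forall i, multiplier (phi i)) -> multiplier (fun xi => \prod_(i <- s) phi i xi).
Proof.
move=> Mphi; elim: s => [|i s IH].
  by under eq_fun do rewrite big_nil; exact: multiplier_cst.
by under eq_fun do rewrite big_cons; exact: multiplierM.
Qed.

Definition cell (a b : V) : set V := [set xi | forall j, a 0 j < xi 0 j < b 0 j].

Lemma cellE (a b xi : V) : (\1_(cell a b) xi : R) = \prod_j
  ((a 0 j < dotp (evec R j) xi)%R%:R * (- b 0 j < dotp (- evec R j) xi)%R%:R).
Proof.
rewrite indicE; have [/set_mem H|/negP H] := boolP (xi \in cell a b).
  rewrite big1// => j _; rewrite dotpNl dotpC dotp_evec ltrN2.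
  by have /andP[-> ->] := H j; rewrite mulr1.
have /existsNP[j Hj] : ~ forall j, a 0 j < xi 0 j < b 0 j by move=> K; apply: H; exact: mem_set.
rewrite (bigD1 j)//= dotpNl dotpC dotp_evec ltrN2 -natrM mulnb.
by rewrite (negbTE (introN idP Hj)) mul0r.
Qed.

Lemma multiplier_cell (a b : V) : multiplier (\1_(cell a b) : BRn R n -> R).
Proof.
have -> : (\1_(cell a b) : BRn R n -> R) = (fun xi => \prod_j
  ((a 0 j < dotp (evec R j) xi)%R%:R * (- b 0 j < dotp (- evec R j) xi)%R%:R)).
  by apply/funext => xi; exact: cellE.
by apply: multiplier_prod => j; apply: multiplierM; exact: multiplier_halfspace.
Qed.

Hypothesis real_fourier : forall x, Rintegral mu setT
  (fun xi => q xi * cos (dotp x xi) + p xi * sin (dotp x xi)) = 0.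

(** The two sides differ by -2 sin c times the imaginary part of the Fourier transform, which
    vanishes. *)
Lemma symmetric1 : symmetric (fun=> 1).
Proof.
move=> c x; apply/eqP; rewrite -subr_eq0; apply/eqP.
rewrite /waveint -RintB; try by apply: itg_wave_mul; exact: admissible_cst.
have iw : itg mu (fun xi => q xi * cos (dotp x xi) + p xi * sin (dotp x xi)).
  have E (f : R -> R) xi : f (dotp x xi) = f (0 + dotp x xi) by rewrite add0r.
  apply: itgD; apply: itgM => //; try exact: bounded_cos; try exact: bounded_sin.
    by under eq_fun do rewrite E; exact: cos_phase.
  by under eq_fun do rewrite (E (@sin R)); exact: sin_phase.
transitivity (Rintegral mu setT (fun xi => (- 2 * sin c) *
  (q xi * cos (dotp x xi) + p xi * sin (dotp x xi)))); last first.
  by rewrite RintZ// real_fourier mulr0.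
congr (Rintegral _ _ _); apply/funext => xi.
by rewrite /wave /flip !mulr1 !cosD !sinD cosN sinN; ring.
Qed.

Lemma symmetric_cell (a b : V) : symmetric (\1_(cell a b) : BRn R n -> R).
Proof.
have [_ /(_ (fun=> 1) (admissible_cst 1) symmetric1)] := multiplier_cell a b.
by under eq_fun do rewrite mulr1.
Qed.

End spectral_symmetry.

(** * Oscillatory integrals against a concentrated density *)

Section cosine_integral.
Context {R : realType} {n : nat} (mu : {measure set (BRn R n) -> \bar R}).
Local Notation V := 'rV[R]_n.
Implicit Types (P b : BRn R n -> R) (x : V) (c : R).

(** The factor is bounded only where [P] does not vanish: differentiating in x brings down a
    coordinate of xi, which is unbounded on the whole space. *)
Lemma itg_supp P b (M : R) : itg mu P -> measurable_fun setT b ->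
  (forall xi, P xi != 0 -> `|b xi| <= M) -> itg mu (fun xi => P xi * b xi).
Proof.
move=> iP mb bM; have mP := itg_measurable iP.
apply: (@le_integrable _ _ _ _ _ _ _ (EFin \o (fun xi => M * P xi))) => //; last exact: itgZ.
  by apply/measurable_EFinP; exact: measurable_funM.
move=> xi _ /=; rewrite lee_fin !normrM.
have [->|P0] := eqVneq (P xi) 0; first by rewrite normr0 mul0r mulr0.
by rewrite mulrC ler_wpM2r// (le_trans (bM xi P0))// ler_norm.
Qed.

Lemma Rint_supp_le P b (M : R) : itg mu P -> measurable_fun setT b ->
  (forall xi, P xi != 0 -> `|b xi| <= M) ->
  `|Rintegral mu setT (fun xi => P xi * b xi)| <= M * Rintegral mu setT (fun xi => `|P xi|).
Proof.
move=> iP mb bM; have iPb := itg_supp iP mb bM.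
have iaP : itg mu (fun xi => `|P xi|) := integrable_norm iP.
apply: le_trans (le_normr_Rintegral measurableT iPb) _.
rewrite -RintZ//; apply: le_Rintegral => //.
- exact: (integrable_norm iPb).
- exact: itgZ.
move=> xi _; rewrite normrM.
have [->|P0] := eqVneq (P xi) 0; first by rewrite normr0 mul0r mulr0.
by rewrite mulrC ler_wpM2r// bM.
Qed.

Definition cosint P c x : R := Rintegral mu setT (fun xi => P xi * cos (c + dotp x xi)).

Lemma cos_taylor (a u : R) : `|cos (a + u) - cos a + u * sin a| <= u ^+ 2.
Proof.
pose f (t : R) := cos (a + t) + t * sin a.
have D (t : R) : is_derive t (1:R) f (- sin (a + t) + sin a).
  apply: (is_derive_eq (derD (is_derive1_comp (is_derive_cos (a + t))
    (derD (dercst a t 1) (is_derive_id t 1))) (derM (is_derive_id t 1) (dercst (sin a) t 1)))).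
  by rewrite add0r !mulr1 mulr0 add0r.
have := @mvt_dist R f _ u 0 `|u| D.
rewrite /f addr0 mul0r addr0 subr0 -expr2 real_normK ?num_real//.
rewrite -addrA (addrC (u * _)) addrA; apply => t _; rewrite subr0 => tu.
by rewrite addrC (le_trans (sin_dist _ _))// opprD addrA subrr sub0r normrN.
Qed.

Lemma coord_BRn (j : 'I_n) : measurable_fun setT (fun xi : BRn R n => (xi : V) 0 j).
Proof. by apply: cont_BRn; exact: coord_cont. Qed.

Lemma itg_cosint P c x : itg mu P -> itg mu (fun xi => P xi * cos (c + dotp x xi)).
Proof. by move=> iP; apply: itgM => //; [exact: cos_phase|exact: bounded_cos]. Qed.

Section concentrated.
Context (P : BRn R n -> R) (xi0 : V) (eta : R) (iP : itg mu P).
Hypothesis P_supp : forall xi : BRn R n, P xi != 0 -> forall j, `|(xi : V) 0 j - xi0 0 j| <= eta.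

Let coord_supp j (xi : BRn R n) : P xi != 0 -> `|(xi : V) 0 j| <= `|xi0 0 j| + eta.
Proof.
move=> /P_supp /(_ j) H; rewrite -[(xi : V) 0 j](subrK (xi0 0 j)) addrC.
by apply: le_trans (ler_normD _ _) _; rewrite lerD2l.
Qed.

Let itg_dcos c x j : itg mu (fun xi => P xi * (- (xi : V) 0 j * sin (c + dotp x xi))).
Proof.
apply: (@itg_supp _ _ (`|xi0 0 j| + eta)) => //.
  apply: measurable_funM; last exact: sin_phase.
  by apply: measurableT_comp => //; exact: coord_BRn.
move=> xi /coord_supp H; rewrite normrM normrN -[leRHS]mulr1.
by apply: ler_pM => //; exact: sin_max.
Qed.

(** The second-order Taylor remainder of the cosine is at most (h xi_j)^2, and xi_j is bounded on
    the support of [P], so the remainder can be integrated. *)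
Lemma cosint_der c x j : is_derive x (evec R j) (cosint P c)
  (Rintegral mu setT (fun xi => P xi * (- (xi : V) 0 j * sin (c + dotp x xi)))).
Proof.
apply/is_derive_line.
apply: (@is_derive_quadratic _ _ _ _
  ((`|xi0 0 j| + eta) ^+ 2 * Rintegral mu setT (fun xi => `|P xi|))) => h.
rewrite addr0 scale0r add0r /cosint mulrC.
rewrite -RintB; try exact: itg_cosint.
rewrite -RintZ; last exact: itg_dcos.
rewrite -RintB; [|by apply: itgB; exact: itg_cosint|by apply: itgZ; exact: itg_dcos].
have -> : (fun xi : BRn R n => P xi * cos (c + dotp (h *: evec R j + x) xi) -
    P xi * cos (c + dotp x xi) - h * (P xi * (- (xi : V) 0 j * sin (c + dotp x xi)))) =
  (fun xi : BRn R n => P xi * (cos (c + dotp (h *: evec R j + x) xi) -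
    cos (c + dotp x xi) + h * (xi : V) 0 j * sin (c + dotp x xi))).
  by apply/funext => xi; ring.
rewrite mulrAC; apply: Rint_supp_le => //.
  apply: measurable_funD; first by apply: measurable_funB; exact: cos_phase.
  apply: measurable_funM; last exact: sin_phase.
  by apply: measurable_funM; [exact: measurable_cst|exact: coord_BRn].
move=> xi /coord_supp H; rewrite dotpDl dotpZl (dotpC (evec R j)) dotp_evec.
rewrite addrCA addrC; apply: le_trans (cos_taylor _ _) _.
rewrite exprMn mulrC ler_wpM2r ?sqr_ge0// -[leLHS]real_normK ?num_real//.
by rewrite ler_sqr ?nnegrE// (le_trans (normr_ge0 _) (H j)).
Qed.

Lemma dotp_dist (L : R) x (xi : V) : box L x -> (forall j, `|xi 0 j - xi0 0 j| <= eta) ->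
  `|dotp x xi - dotp x xi0| <= n%:R * (L * eta).
Proof.
move=> Kx H; rewrite /dotp -sumrB; apply: le_trans (ler_norm_sum _ _ _) _.
rewrite -[n in n%:R]card_ord -sumr_const mulr_suml.
by apply: ler_sum => j _; rewrite mul1r -mulrBr normrM; apply: ler_pM.
Qed.

(** The error involves the integral of |P|, which cancellation can make much larger than that of
    [P]; this is why total variations have to be controlled. *)
Lemma cosint_near (L : R) c x : box L x ->
  `|cosint P c x - Rintegral mu setT P * cos (c + dotp x xi0)| <=
    n%:R * (L * eta) * Rintegral mu setT (fun xi => `|P xi|).
Proof.
move=> Kx; rewrite /cosint [X in _ - X]mulrC -(RintZ _ iP) -RintB; [|exact: itg_cosint|exact: itgZ].
have -> : (fun xi : BRn R n => P xi * cos (c + dotp x xi) - cos (c + dotp x xi0) * P xi) =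
  (fun xi : BRn R n => P xi * (cos (c + dotp x xi) - cos (c + dotp x xi0))).
  by apply/funext => xi; ring.
apply: Rint_supp_le => //.
  by apply: measurable_funB; [exact: cos_phase|exact: measurable_cst].
move=> xi /P_supp H; apply: le_trans (cos_dist _ _) _.
by rewrite opprD addrACA subrr add0r; exact: dotp_dist.
Qed.

Lemma dcosint_near (L : R) c x j : box L x ->
  `|partial (cosint P c) j x - Rintegral mu setT P * (- xi0 0 j * sin (c + dotp x xi0))| <=
    (eta + `|xi0 0 j| * (n%:R * (L * eta))) * Rintegral mu setT (fun xi => `|P xi|).
Proof.
move=> Kx; rewrite (partialE (cosint_der c x j)) [X in _ - X]mulrC -(RintZ _ iP).
rewrite -RintB; [|exact: itg_dcos|exact: itgZ].
have -> : (fun xi : BRn R n => P xi * (- (xi : V) 0 j * sin (c + dotp x xi)) -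
   - xi0 0 j * sin (c + dotp x xi0) * P xi) =
  (fun xi : BRn R n => P xi * (- (((xi : V) 0 j - xi0 0 j) * sin (c + dotp x xi) +
     xi0 0 j * (sin (c + dotp x xi) - sin (c + dotp x xi0))))).
  by apply/funext => xi; ring.
apply: Rint_supp_le => //.
  apply: measurableT_comp => //; apply: measurable_funD; apply: measurable_funM => //.
  - by apply: measurable_funB; [exact: coord_BRn|exact: measurable_cst].
  - exact: sin_phase.
  - by apply: measurable_funB; [exact: sin_phase|exact: measurable_cst].
move=> xi /P_supp H; rewrite normrN; apply: le_trans (ler_normD _ _) _; rewrite !normrM.
apply: lerD; first by rewrite -[leRHS]mulr1; apply: ler_pM => //; exact: sin_max.
apply: ler_wpM2l => //; apply: le_trans (sin_dist _ _) _.
by rewrite opprD addrACA subrr add0r; exact: dotp_dist.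
Qed.

End concentrated.
End cosine_integral.

(** * The Cameron-Martin functions attached to small cells *)

Section complex_integral.
Context {R : realType}.
Implicit Types (z w : R[i]).

Lemma cReM z w : complex.Re (z * w) = complex.Re z * complex.Re w - complex.Im z * complex.Im w.
Proof. by case: z w => [? ?] [? ?]. Qed.
Lemma cImM z w : complex.Im (z * w) = complex.Re z * complex.Im w + complex.Im z * complex.Re w.
Proof. by case: z w => [? ?] [? ?]. Qed.
Lemma cReD z w : complex.Re (z + w) = complex.Re z + complex.Re w.
Proof. by case: z w => [? ?] [? ?]. Qed.
Lemma cImD z w : complex.Im (z + w) = complex.Im z + complex.Im w.
Proof. by case: z w => [? ?] [? ?]. Qed.
Lemma cRe_sum I (s : seq I) (F : I -> R[i]) :
  complex.Re (\sum_(i <- s) F i) = \sum_(i <- s) complex.Re (F i).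
Proof. by elim: s => [|i s IH]; rewrite ?big_nil ?big_cons// cReD IH. Qed.
Lemma cIm_sum I (s : seq I) (F : I -> R[i]) :
  complex.Im (\sum_(i <- s) F i) = \sum_(i <- s) complex.Im (F i).
Proof. by elim: s => [|i s IH]; rewrite ?big_nil ?big_cons// cImD IH. Qed.
Lemma complex_eq z w : complex.Re z = complex.Re w -> complex.Im z = complex.Im w -> z = w.
Proof. by case: z w => [? ?] [? ?] /= -> ->. Qed.

Lemma cabs_ge0 z : 0 <= cabs z.
Proof. by case: z => a b; exact: sqrtr_ge0. Qed.
Lemma Re_le_cabs z : `|complex.Re z| <= cabs z.
Proof. by case: z => a b /=; rewrite -sqrtr_sqr ler_wsqrtr// lerDl sqr_ge0. Qed.
Lemma Im_le_cabs z : `|complex.Im z| <= cabs z.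
Proof. by case: z => a b /=; rewrite -sqrtr_sqr ler_wsqrtr// lerDr sqr_ge0. Qed.
Lemma cabsM z w : cabs (z * w) = cabs z * cabs w.
Proof. exact: Normc.normcM. Qed.
Lemma cabs_conj z : cabs (Num.conj z) = cabs z.
Proof. by case: z => a b; rewrite /cabs /= sqrrN. Qed.
Lemma cabs_le z : cabs z <= `|complex.Re z| + `|complex.Im z|.
Proof.
case: z => a b; rewrite /cabs /=.
rewrite -[leRHS]ger0_norm ?addr_ge0// -sqrtr_sqr ler_wsqrtr// sqrrD.
by rewrite !real_normK ?num_real// lerD2r lerDl mulrn_wge0// mulr_ge0.
Qed.

Context d (T : measurableType d) (mu : {measure set T -> \bar R}).
Implicit Types (f g : T -> R[i]).

Definition cmeasurable f := measurable_fun setT (fun t => complex.Re (f t)) /\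
  measurable_fun setT (fun t => complex.Im (f t)).
Definition cbounded f := exists M : R, forall t, cabs (f t) <= M.
Definition citg f := itg mu (fun t => complex.Re (f t)) /\ itg mu (fun t => complex.Im (f t)).

Lemma cmeasurableM f g : cmeasurable f -> cmeasurable g -> cmeasurable (fun t => f t * g t).
Proof.
move=> [f1 f2] [g1 g2]; split.
  by under eq_fun do rewrite cReM; apply: measurable_funB; exact: measurable_funM.
by under eq_fun do rewrite cImM; apply: measurable_funD; exact: measurable_funM.
Qed.

Lemma cmeasurableD f g : cmeasurable f -> cmeasurable g -> cmeasurable (fun t => f t + g t).
Proof.
move=> [f1 f2] [g1 g2]; split.
  by under eq_fun do rewrite cReD; exact: measurable_funD.
by under eq_fun do rewrite cImD; exact: measurable_funD.
Qed.

Lemma cmeasurable_cabs f : cmeasurable f -> measurable_fun setT (fun t => cabs (f t)).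
Proof.
move=> [f1 f2].
have -> : (fun t => cabs (f t)) =
    (fun t => Num.sqrt (complex.Re (f t) ^+ 2 + complex.Im (f t) ^+ 2)).
  by apply/funext => t; case: (f t).
apply: measurableT_comp; first by apply: continuous_measurable_fun; exact: sqrt_continuous.
by apply: measurable_funD; exact: measurable_funX.
Qed.

Lemma cboundedM f g : cbounded f -> cbounded g -> cbounded (fun t => f t * g t).
Proof.
move=> [M fM] [N gN]; exists (M * N) => t; rewrite cabsM.
by apply: ler_pM => //; exact: cabs_ge0.
Qed.

Lemma cboundedD f g : cbounded f -> cbounded g -> cbounded (fun t => f t + g t).
Proof.
move=> [M fM] [N gN]; exists (M + M + (N + N)) => t.
apply: le_trans (cabs_le _) _; rewrite cReD cImD.
have := ler_normD (complex.Re (f t)) (complex.Re (g t)).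
have := ler_normD (complex.Im (f t)) (complex.Im (g t)).
have := Re_le_cabs (f t); have := Re_le_cabs (g t).
have := Im_le_cabs (f t); have := Im_le_cabs (g t).
by have := fM t; have := gN t; lra.
Qed.

Lemma citgM f g : citg g -> cmeasurable f -> cbounded f -> citg (fun t => f t * g t).
Proof.
move=> [g1 g2] [f1 f2] [M fM].
have b1 : bounded_real (fun t => complex.Re (f t)).
  by exists M => t; exact: le_trans (Re_le_cabs _) (fM t).
have b2 : bounded_real (fun t => complex.Im (f t)).
  by exists M => t; exact: le_trans (Im_le_cabs _) (fM t).
have E (u v : T -> R) : (fun t => u t * v t) = (fun t => v t * u t).
  by apply/funext => t; rewrite mulrC.
split.
  by under eq_fun do rewrite cReM; apply: itgB; rewrite E; exact: itgM.
by under eq_fun do rewrite cImM; apply: itgD; rewrite E; exact: itgM.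
Qed.

Lemma cintegralD f g : citg f -> citg g ->
  cintegral mu setT (fun t => f t + g t) = cintegral mu setT f + cintegral mu setT g.
Proof.
move=> [f1 f2] [g1 g2]; apply: complex_eq => /=.
  by rewrite -RintD//; under eq_fun do rewrite cReD.
by rewrite -RintD//; under eq_fun do rewrite cImD.
Qed.

End complex_integral.

(** * L^1 bounds on the density from the total variation *)

Section total_variation.
Context {R : realType} {n m : nat} (mu : {finite_measure set (BRn R n) -> \bar R}).
Context (h : 'I_m -> 'I_m -> BRn R n -> R[i]).

Lemma Rint_indic (U : set (BRn R n)) (f : BRn R n -> R) :
  Rintegral mu U f = Rintegral mu setT (fun xi => f xi * \1_U xi).
Proof.
rewrite Rintegral_mkcond; congr (Rintegral _ _ _); apply/funext => xi.
rewrite patchE indicE; case: (xi \in U); first by rewrite mulr1.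
by rewrite mulr0.
Qed.

Lemma itg_indic (U : set (BRn R n)) (f : BRn R n -> R) :
  measurable U -> itg mu f -> itg mu (fun xi => f xi * \1_U xi).
Proof.
move=> mU itf; apply: itgM => //; exists 1 => xi.
by rewrite indicE; case: (_ \in _); rewrite ?normr1 ?normr0.
Qed.

(* Cutting U along the sign of f bounds the L^1 norm of a real part of the density by the
   total variation. *)
Lemma rho_tv_ge i j (U : set (BRn R n)) (f : BRn R n -> R) (C : R) :
  measurable U -> itg mu f ->
  (forall A, `|Rintegral mu A f| <= cabs (rho mu h i j A)) ->
  (rho_tv mu h i j U <= C%:E)%E ->
  Rintegral mu setT (fun xi => `|f xi * \1_U xi|) <= C.
Proof.
move=> mU itf fh tv; have mf := itg_measurable itf.
pose D : set (BRn R n) := [set xi | 0 <= f xi].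
have mD : measurable D.
  rewrite (_ : D = setT `&` f @^-1` `[0, +oo[%classic).
    by apply: mf => //; exact: measurable_itv.
  by apply/seteqP; split=> xi; rewrite /D /= in_itv /= andbT => // -[].
pose A (l : 'I_2) : set (BRn R n) := if l == ord0 then U `&` D else U `\` D.
have mA l : measurable (A l).
  by rewrite /A; case: ifP => _; [exact: measurableI|exact: measurableD].
have part : ((\sum_(l < 2) cabs (rho mu h i j (A l)))%:E <= C%:E)%E.
  apply: le_trans tv; apply: ereal_sup_ubound; exists 2%N, A; split=> //; split; last split=> //.
    move=> k l _ _ [xi []]; rewrite /A.
    have [->|k0] := eqVneq k ord0; have [->|l0] := eqVneq l ord0 => //.
    - by move=> [_ Dx] [_].
    - by move=> [_ Dx] [_].
    - move=> _ _; apply/val_inj => /=.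
      have one (u : 'I_2) : u != ord0 -> val u = 1%N by case: u => -[|[|]].
      by rewrite (one k k0) (one l l0).
  apply/seteqP; split=> [xi [l _]|xi Uxi]; first by rewrite /A; case: ifP => _ [].
  have [Dx|Dx] := pselect (D xi); first by exists ord0 => //; rewrite /A eqxx.
  by exists ord_max.
apply: le_trans (_ : \sum_(l < 2) cabs (rho mu h i j (A l)) <= _); last by rewrite -lee_fin.
rewrite !big_ord_recl big_ord0 addr0.
apply: le_trans (lerD (fh _) (fh _)).
apply: le_trans (ler_normB _ _); apply: le_trans (ler_norm _).
rewrite (Rint_indic (A ord0)) (Rint_indic (A (lift ord0 ord0))) -RintB; try exact: itg_indic.
apply: le_Rintegral => //.
- by apply: integrable_norm; exact: itg_indic.
- by apply: itgB; exact: itg_indic.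
move=> xi _; rewrite /A /= !indicE in_setI in_setD.
case: (xi \in U); last by rewrite /= !mulr0 normr0 subr0.
have [/set_mem Dx|nDx] := boolP (xi \in D); rewrite /= !mulr1 !mulr0.
  by rewrite subr0 ger0_norm.
rewrite sub0r ler0_norm//.
have [//|f0] := leP (f xi) 0.
by rewrite mem_set in nDx => //; exact: ltW.
Qed.

End total_variation.

(** * Members of H_0 given by bounded Hermitian functions and by cells *)

Section cameron_martin.
Context {R : realType} {n m : nat} (mu : {finite_measure set (BRn R n) -> \bar R}).
Context (h : 'I_m -> 'I_m -> BRn R n -> R[i]) (k : 'I_m -> 'I_m -> 'rV[R]_n -> R).
Hypothesis spec : spectral_measure_of mu h k.
Local Notation V := 'rV[R]_n.

Lemma density_measurable i j : cmeasurable (h i j).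
Proof. by case: spec => -[+ _] _; move/(_ i j). Qed.

Lemma itg_cabs_density i j : itg mu (fun xi => cabs (h i j xi)).
Proof.
apply/integrableP; split.
  by apply/measurable_EFinP; exact: cmeasurable_cabs (density_measurable i j).
have [[_ [/(_ i j) H _]] _] := spec.
by under eq_integral do rewrite /= ger0_norm ?cabs_ge0//.
Qed.

Lemma citg_density i j : citg mu (h i j).
Proof.
have [m1 m2] := density_measurable i j.
have H (f : BRn R n -> R) : measurable_fun setT f ->
    (forall xi, `|f xi| <= cabs (h i j xi)) -> itg mu f.
  move=> mf fh; apply: (@le_integrable _ _ _ _ _ _ _ (EFin \o (fun xi => cabs (h i j xi)))) => //.
  - exact/measurable_EFinP.
  - by move=> xi _ /=; rewrite lee_fin [leRHS]ger0_norm ?cabs_ge0.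
  - exact: itg_cabs_density.
by split; apply: H => // xi; [exact: Re_le_cabs|exact: Im_le_cabs].
Qed.

Lemma density_real_fourier i j (x : V) : Rintegral mu setT
  (fun xi => complex.Im (h i j xi) * cos (dotp x xi) +
             complex.Re (h i j xi) * sin (dotp x xi)) = 0.
Proof.
have [_ /(_ i j x)/(congr1 (@complex.Im R))] := spec.
rewrite [LHS]/= /rho_int /cintegral [RHS]/= => E; rewrite [RHS]E.
congr (Rintegral _ _ _); apply/funext => xi; rewrite cImM [in RHS]/= addrC.
by rewrite addrC mulrC [X in _ + X]mulrC addrC.
Qed.

(** Boundedness is preserved by sums, whereas the integrability required in [L2H] would bring in
    mixed terms of two functions; it also implies that integrability, as the densities are
    integrable. *)
Definition H0_bounded (F : 'I_m -> V -> R) := exists G : 'I_m -> BRn R n -> R[i],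
  [/\ forall i, cmeasurable (G i), forall i, cbounded (G i),
      forall (xi : V) i, G i (- xi) = Num.conj (G i xi) &
      forall i x, real_complex R (F i x) = F_rho mu h G i x].

Lemma H0_boundedW F : H0_bounded F -> H0 mu h F.
Proof.
move=> [G [mG bG hG FG]]; exists G; split=> //; split=> //; split=> // i j.
have [M GM] := cboundedM (bG i) (bG j).
have : itg mu (fun xi => cabs (h i j xi) * (cabs (G i xi) * cabs (G j xi))).
  apply: itgM; first exact: itg_cabs_density.
    by apply: measurable_funM; exact: cmeasurable_cabs.
  by exists M => xi; rewrite -cabsM ger0_norm ?cabs_ge0.
move=> /integrableP[_]; apply: le_lt_trans; rewrite le_eqVlt; apply/orP; left; apply/eqP.
apply: eq_integral => xi _ /=; congr EFin.
by rewrite !cabsM cabs_conj ger0_norm ?mulr_ge0 ?cabs_ge0// mulrC.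
Qed.

Lemma cexpi_measurable (x : V) : cmeasurable (fun xi : BRn R n => cexpi (- dotp x xi)).
Proof.
have E (f : R -> R) : (fun xi : BRn R n => f (- dotp x xi)) = (fun xi => f (0 + dotp (- x) xi)).
  by apply/funext => xi; rewrite dotpNl add0r.
by split; rewrite /= E; [exact: cos_phase|exact: sin_phase].
Qed.

Lemma cexpi_bounded (x : V) : cbounded (fun xi : BRn R n => cexpi (- dotp x xi)).
Proof. by exists 1 => xi; rewrite /cabs /= cos2Dsin2 sqrtr1. Qed.

Lemma H0_boundedD F F' : H0_bounded F -> H0_bounded F' ->
  H0_bounded (fun i x => F i x + F' i x).
Proof.
move=> [G [mG bG hG FG]] [G' [mG' bG' hG' FG']].
exists (fun i xi => G i xi + G' i xi); split.
- by move=> i; exact: cmeasurableD.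
- by move=> i; exact: cboundedD.
- by move=> xi i; rewrite hG hG' rmorphD.
move=> i x; rewrite rmorphD /= FG FG' /F_rho -big_split; apply: eq_bigr => j _.
have ci (g : BRn R n -> R[i]) : cmeasurable g -> cbounded g ->
    citg mu (fun xi => cexpi (- dotp x xi) * g xi * h j i xi).
  move=> mg bg; apply: citgM; first exact: citg_density.
    by apply: cmeasurableM => //; exact: cexpi_measurable.
  by apply: cboundedM => //; exact: cexpi_bounded.
rewrite /= /rho_int -cintegralD; try exact: ci.
by congr (cintegral _ _ _); apply/funext => xi; rewrite mulrDr mulrDl.
Qed.

Lemma H0_bounded0 : H0_bounded (fun _ _ => 0).
Proof.
exists (fun _ _ => 0); split.
- by move=> i; split; exact: measurable_cst.
- by move=> i; exists 0 => xi; rewrite /cabs /= expr0n /= addr0 sqrtr0.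
- by move=> xi i; rewrite rmorph0.
move=> i x; rewrite /F_rho big1 ?rmorph0// => j _.
rewrite /rho_int.
have -> : (fun xi : BRn R n => cexpi (- dotp x xi) * 0 * h j i xi) = (fun=> 0).
  by apply/funext => xi; rewrite mulr0 mul0r.
have Z : Rintegral mu setT (fun=> 0 : R) = 0 by rewrite Rintegral_cst// mul0r.
by apply: complex_eq => /=; rewrite Z.
Qed.

Section cell_member.
Context (l u : V).
Local Notation ind := (\1_(cell l u) : BRn R n -> R).
Local Notation indn := (fun xi : BRn R n => ind (- (xi : V))).

(** Admissibility does not involve the densities, so it can be read off with both equal to 0. *)
Let adm_ind : admissible ind := (multiplier_cell (p := fun=> 0) (q := fun=> 0)
  (integrable0 mu _) (integrable0 mu _) l u).1.

Definition hermitian_cell (g : R[i]) (xi : BRn R n) : R[i] :=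
  g * Complex (ind xi) 0 + Num.conj g * Complex (indn xi) 0.

Lemma itg_cell i s (g : R[i]) :
  itg mu (fun xi => complex.Re (g * h i s xi) * ind xi) /\
  itg mu (fun xi => complex.Im (g * h i s xi) * ind xi).
Proof.
have [mi bi] := adm_ind.
have [c1 c2] : citg mu (fun xi => g * h i s xi).
  apply: citgM; first exact: citg_density.
    by split; exact: measurable_cst.
  by exists (cabs g).
by split; apply: itgM.
Qed.

(** By symmetry the part over the reflected cell is the conjugate of the part over the cell, so the
    sum is twice a real part. With P + i Q = g h on the cell, the real part of (P + i Q)
    e^(-i<x,xi>) is P cos + Q sin; the sine is the cosine with phase -pi/2. *)
Lemma rho_int_cell i s (g : R[i]) (x : V) :
  rho_int mu h i s (fun xi => cexpi (- dotp x xi) * hermitian_cell g xi) =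
  Complex (2 * (cosint mu (fun xi => complex.Re (g * h i s xi) * ind xi) 0 x +
                cosint mu (fun xi => complex.Im (g * h i s xi) * ind xi) (- (pi / 2)) x)) 0.
Proof.
have [ip iq] := citg_density i s.
set p := (fun xi => complex.Re (h i s xi)) in ip; set q := (fun xi => complex.Im (h i s xi)) in iq.
have sym := @symmetric_cell _ _ mu p q ip iq (density_real_fourier i s) l u.
(* Phases 0 and -pi/2 give the real and imaginary parts of the integral of e^(-i<x,xi>) b against
   rho_is; reflecting the cell keeps the former ([sA]) and negates the latter ([sB]). *)
pose W c b := waveint mu p q c (- x) b.
have sA : W 0 ind = W 0 indn by have := sym 0 (- x); rewrite oppr0.
have sB : W (- (pi / 2)) indn = - W (- (pi / 2)) ind.
  have := sym (- (pi / 2)) (- x); rewrite opprK => E.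
  rewrite /W E -[RHS]mulN1r -(waveintZ ip iq); last exact: admissible_flip.
  congr (Rintegral _ _ _); apply/funext => xi.
  rewrite /wave /flip; move: (dotp (- x) xi) => th.
  by rewrite (addrC (- _)) cosBpihalf sinBpihalf (addrC (pi / 2)) cosDpihalf sinDpihalf; ring.
have adn : admissible indn by exact: admissible_flip.
have adZ a b : admissible b -> admissible (fun xi : BRn R n => a * b xi).
  by move=> ab; apply: admissibleM => //; exact: admissible_cst.
have cs (xi : BRn R n) : wave p q 0 (- x) xi = p xi * cos (dotp x xi) + q xi * sin (dotp x xi).
  by rewrite /wave add0r dotpNl cosN sinN mulrN opprK.
have cq (xi : BRn R n) :
    wave p q (- (pi / 2)) (- x) xi = q xi * cos (dotp x xi) - p xi * sin (dotp x xi).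
  by rewrite /wave dotpNl -opprD cosN sinN (addrC (pi / 2)) cosDpihalf sinDpihalf; ring.
case: g => al be.
have lin a1 b1 a2 b2 (f1 f2 f3 f4 : BRn R n -> R) : admissible f1 -> admissible f2 ->
    admissible f3 -> admissible f4 ->
    Rintegral mu setT (fun xi => wave p q 0 (- x) xi * (a1 * f1 xi + b1 * f2 xi) +
      wave p q (- (pi / 2)) (- x) xi * (a2 * f3 xi + b2 * f4 xi)) =
    a1 * W 0 f1 + b1 * W 0 f2 + (a2 * W (- (pi / 2)) f3 + b2 * W (- (pi / 2)) f4).
  move=> A1 A2 A3 A4.
  rewrite RintD; try by apply: itg_wave_mul => //; apply: admissibleD; exact: adZ.
  by congr (_ + _); rewrite -!waveintZ// -waveintD//; exact: adZ.
apply: complex_eq => /=.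
- have -> : (fun xi : BRn R n => complex.Re (cexpi (- dotp x xi) *
      hermitian_cell (Complex al be) xi * h i s xi)) =
    (fun xi => wave p q 0 (- x) xi * (al * ind xi + al * indn xi) +
      wave p q (- (pi / 2)) (- x) xi * (- be * ind xi + be * indn xi)).
    apply/funext => xi; rewrite cs cq !(cReM, cImM) /hermitian_cell !(cReD, cImD, cReM, cImM) /=.
    by rewrite cosN sinN -/(p xi) -/(q xi); ring.
  rewrite lin// -sA sB /cosint -RintD; last 2 first.
  + by apply: itg_cosint; case: (itg_cell i s (Complex al be)).
  + by apply: itg_cosint; case: (itg_cell i s (Complex al be)).
  have -> : (fun xi : BRn R n => complex.Re (Complex al be * h i s xi) * ind xi * cos (0 + dotp x xi) +
      complex.Im (Complex al be * h i s xi) * ind xi * cos (- (pi / 2) + dotp x xi)) =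
    (fun xi => wave p q 0 (- x) xi * (al * ind xi + 0 * ind xi) +
      wave p q (- (pi / 2)) (- x) xi * (- be * ind xi + 0 * ind xi)).
    apply/funext => xi; rewrite cs cq cReM cImM /= add0r (addrC (- _)) cosBpihalf.
    by rewrite -/(p xi) -/(q xi); ring.
  by rewrite lin//; ring.
- have -> : (fun xi : BRn R n => complex.Im (cexpi (- dotp x xi) *
      hermitian_cell (Complex al be) xi * h i s xi)) =
    (fun xi => wave p q 0 (- x) xi * (be * ind xi + - be * indn xi) +
      wave p q (- (pi / 2)) (- x) xi * (al * ind xi + al * indn xi)).
    apply/funext => xi; rewrite cs cq !(cReM, cImM) /hermitian_cell !(cReD, cImD, cReM, cImM) /=.
    by rewrite cosN sinN -/(p xi) -/(q xi); ring.
  by rewrite lin// -sA sB; ring.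
Qed.

Lemma cosint_sum (P : 'I_m -> BRn R n -> R) c (x : V) : (forall i, itg mu (P i)) ->
  cosint mu (fun xi => \sum_i P i xi) c x = \sum_i cosint mu (P i) c x.
Proof.
move=> iP; rewrite /cosint -Rint_sum; last by move=> i; exact: itg_cosint.
by congr (Rintegral _ _ _); apply/funext => xi; rewrite mulr_suml.
Qed.

Lemma H0_bounded_cell (g : 'I_m -> R[i]) : H0_bounded (fun s x => 2 *
  (cosint mu (fun xi => \sum_i complex.Re (g i * h i s xi) * ind xi) 0 x +
   cosint mu (fun xi => \sum_i complex.Im (g i * h i s xi) * ind xi) (- (pi / 2)) x)).
Proof.
have [mi [M iM]] := adm_ind; have [mn [N nN]] := admissible_flip adm_ind.
exists (fun i => hermitian_cell (g i)); split.
- move=> i; have cst (z : R[i]) : cmeasurable (fun _ : BRn R n => z) by split; exact: measurable_cst.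
  by apply: cmeasurableD; apply: cmeasurableM => //; split => //=; exact: measurable_cst.
- move=> i; have cst (z : R[i]) : cbounded (fun _ : BRn R n => z) by exists (cabs z).
  apply: cboundedD; apply: cboundedM => //.
    by exists M => xi; rewrite /cabs /= expr0n addr0 sqrtr_sqr.
  by exists N => xi; rewrite /cabs /= expr0n addr0 sqrtr_sqr; exact: nN.
- move=> xi i; rewrite /hermitian_cell opprK rmorphD !rmorphM /= conjCK addrC.
  by congr (_ * _ + _ * _); apply: complex_eq => //=; rewrite oppr0.
move=> s x; rewrite /F_rho; under eq_bigr do rewrite rho_int_cell.
rewrite !cosint_sum; try by move=> i; case: (itg_cell i s (g i)).
apply: complex_eq; rewrite /= ?cRe_sum ?cIm_sum /=; last by rewrite big1.
by rewrite -mulr_sumr big_split.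
Qed.

End cell_member.
End cameron_martin.

(** * Cosines as C^1 limits of members of H_0 *)

Section concentration.
Context {R : realType} {n m : nat} (mu : {finite_measure set (BRn R n) -> \bar R}).
Context (h : 'I_m -> 'I_m -> BRn R n -> R[i]) (k : 'I_m -> 'I_m -> 'rV[R]_n -> R).
Hypothesis spec : spectral_measure_of mu h k.
Local Notation V := 'rV[R]_n.

Definition H0_limit (L : R) (Tg : 'I_m -> V -> R) := forall e : R, 0 < e -> exists F,
  [/\ H0_bounded mu h F, forall s, derivable_everywhere (F s) &
      forall s, clo L (F s) (Tg s) e].

Lemma H0_limitD (L : R) Tg Tg' :
  (forall s, derivable_everywhere (Tg s)) -> (forall s, derivable_everywhere (Tg' s)) ->
  H0_limit L Tg -> H0_limit L Tg' -> H0_limit L (fun s x => Tg s x + Tg' s x).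
Proof.
move=> DT DT' A A' e e0; have e2 : 0 < e / 2 by lra.
have [F [HF DF cF]] := A _ e2; have [F' [HF' DF' cF']] := A' _ e2.
exists (fun s x => F s x + F' s x); split.
- exact: (H0_boundedD spec).
- by move=> s x j; apply: derivableD; [exact: DF|exact: DF'].
- by move=> s; rewrite [e]splitr; apply: clo_add.
Qed.

Lemma H0_limit0 (L : R) : H0_limit L (fun _ _ => 0).
Proof.
move=> e e0; exists (fun _ _ => 0); split.
- exact: H0_bounded0.
- by move=> s x j; exact: derivable_cst.
- by move=> s x _; split=> [|j]; rewrite subrr normr0 ltW.
Qed.

Lemma eball_open (y : V) (r : R) : open (eball y r).
Proof.
have cf : continuous (fun x : V => \sum_j (x 0 j - y 0 j) ^+ 2).
  apply: contsum => j; under eq_fun do rewrite expr2.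
  by apply: contM; apply: contD; (exact: coord_cont || exact: contcst).
have -> : eball y r = (fun x : V => \sum_j (x 0 j - y 0 j) ^+ 2) @^-1` [set t | t < r ^+ 2].
  by [].
by apply: open_comp; [move=> x _; exact: cf|exact: open_lt].
Qed.

(** Strict because n / (n + 1)^2 < 1; dividing by n + 1 also covers n = 0. *)
Lemma cube_eball (y : V) (r : R) : 0 < r -> cube y (r / n.+1%:R) `<=` eball y r.
Proof.
move=> r0 x Kx; rewrite /eball /=.
pose q := r / n.+1%:R.
have q0 : 0 < q by rewrite divr_gt0.
apply: le_lt_trans (_ : n%:R * q ^+ 2 < _).
  rewrite -[n in n%:R]card_ord -sumr_const mulr_suml; apply: ler_sum => j _.
  rewrite mul1r -[leLHS]real_normK ?num_real// ler_sqr ?nnegrE//; last exact: ltW.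
have rq : r = n.+1%:R * q by rewrite /q mulrC divfK// pnatr_eq0.
have n0 : 0 <= n%:R :> R by rewrite ler0n.
have : n%:R < n.+1%:R ^+ 2 :> R by rewrite -natr1; nra.
have : 0 < q ^+ 2 by rewrite exprn_gt0.
move=> q2 nn; rewrite [X in _ < X](_ : _ = n.+1%:R ^+ 2 * q ^+ 2); last by rewrite -exprMn -rq.
by rewrite -subr_gt0 -mulrBl mulr_gt0// subr_gt0.
Qed.

Definition around (xi0 : V) (eta : R) : set V := cell (xi0 - const_mx eta) (xi0 + const_mx eta).

(** As a cell the neighbourhood obeys the symmetry of rho; as a ball of the sup norm it is open and
    shrinks to its centre. *)
Lemma aroundE xi0 (eta : R) : 0 < eta -> around xi0 eta = ball xi0 eta.
Proof.
move=> eta0; apply/seteqP; split=> x.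
  move=> H; apply/rV_ballP => // j; have := H j; rewrite !mxE ltr_norml.
  by move=> /andP[? ?]; apply/andP; split; lra.
move=> /(rV_ballP _ _ eta0) H j; have := H j; rewrite !mxE ltr_norml.
by move=> /andP[? ?]; apply/andP; split; lra.
Qed.

Lemma Re_part_rho i j (A : set (BRn R n)) :
  `|Rintegral mu A (fun xi => complex.Re (h i j xi))| <= cabs (rho mu h i j A).
Proof. exact: (Re_le_cabs (rho mu h i j A)). Qed.
Lemma Im_part_rho i j (A : set (BRn R n)) :
  `|Rintegral mu A (fun xi => complex.Im (h i j xi))| <= cabs (rho mu h i j A).
Proof. exact: (Im_le_cabs (rho mu h i j A)). Qed.

Section one_cell.
Context (l u : V) (oU : open (cell l u)).
Local Notation U := (cell l u).
Local Notation ind := (\1_(cell l u) : BRn R n -> R).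

Let mU : measurable (U : set (BRn R n)) := open_BRn oU.

Lemma Rint_cell i s (g : R[i]) :
  Rintegral mu setT (fun xi => complex.Re (g * h i s xi) * ind xi) =
    complex.Re (g * rho mu h i s U) /\
  Rintegral mu setT (fun xi => complex.Im (g * h i s xi) * ind xi) =
    complex.Im (g * rho mu h i s U).
Proof.
have [ip iq] := citg_density spec i s.
have ipU := itg_indic mU ip; have iqU := itg_indic mU iq.
rewrite cReM cImM /= !(Rint_indic mu U) -!RintZ//; split.
  rewrite -RintB; try exact: itgZ.
  by congr (Rintegral _ _ _); apply/funext => xi; rewrite cReM; ring.
rewrite -RintD; try exact: itgZ.
by congr (Rintegral _ _ _); apply/funext => xi; rewrite cImM; ring.
Qed.

(** The factor 2 comes from bounding the real and the imaginary part of the density separately by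
    the total variation. *)
Lemma Rint_norm_cell i s (g : R[i]) (C : R) :
  (rho_tv mu h i s U <= (C * cabs (rho mu h i s U))%:E)%E ->
  Rintegral mu setT (fun xi => `|complex.Re (g * h i s xi) * ind xi|) <=
    2 * cabs g * (C * cabs (rho mu h i s U)) /\
  Rintegral mu setT (fun xi => `|complex.Im (g * h i s xi) * ind xi|) <=
    2 * cabs g * (C * cabs (rho mu h i s U)).
Proof.
move=> tv; have [ip iq] := citg_density spec i s.
have Hp := rho_tv_ge mU ip (Re_part_rho i s) tv.
have Hq := rho_tv_ge mU iq (Im_part_rho i s) tv.
have ipU : itg mu (fun xi => `|complex.Re (h i s xi) * ind xi|) := integrable_norm (itg_indic mU ip).
have iqU : itg mu (fun xi => `|complex.Im (h i s xi) * ind xi|) := integrable_norm (itg_indic mU iq).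
have [icp icq] := itg_cell spec l u i s g.
set D := C * _ in Hp Hq *.
have bound (a b : R) (f : BRn R n -> R) : `|a| <= cabs g -> `|b| <= cabs g -> itg mu f ->
    (forall xi, `|f xi| <= `|a| * `|complex.Re (h i s xi) * ind xi| +
      `|b| * `|complex.Im (h i s xi) * ind xi|) ->
    Rintegral mu setT (fun xi => `|f xi|) <= 2 * cabs g * D.
  move=> ag bg itf fb.
  apply: le_trans (_ : Rintegral mu setT (fun xi => `|a| * `|complex.Re (h i s xi) * ind xi| +
     `|b| * `|complex.Im (h i s xi) * ind xi|) <= _).
    apply: le_Rintegral => //; first exact: (integrable_norm itf).
    by apply: itgD; exact: itgZ.
  rewrite RintD; try exact: itgZ.
  rewrite !RintZ// -mulrA mulr_natl mulr2n; apply: lerD; apply: ler_pM => //;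
    by apply: Rintegral_ge0.
split.
  apply: (bound (complex.Re g) (complex.Im g)) => //; [exact: Re_le_cabs|exact: Im_le_cabs|].
  by move=> xi; rewrite cReM mulrBl -!mulrA -!normrM; exact: ler_normB.
apply: (bound (complex.Im g) (complex.Re g)) => //; [exact: Im_le_cabs|exact: Re_le_cabs|].
by move=> xi; rewrite cImM addrC mulrDl -!mulrA -!normrM; exact: ler_normD.
Qed.

Lemma Rint_norm_sum (P : 'I_m -> BRn R n -> R) (D : 'I_m -> R) :
  (forall i, itg mu (P i)) -> (forall i, Rintegral mu setT (fun xi => `|P i xi|) <= D i) ->
  Rintegral mu setT (fun xi => `|\sum_i P i xi|) <= \sum_i D i.
Proof.
move=> iP PD; have inP i : itg mu (fun xi => `|P i xi|) := integrable_norm (iP i).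
apply: le_trans (_ : \sum_i Rintegral mu setT (fun xi => `|P i xi|) <= _); last exact: ler_sum.
rewrite -Rint_sum//; apply: le_Rintegral => //.
- exact: (integrable_norm (itg_sum _ iP)).
- exact: itg_sum.
- by move=> xi _; exact: ler_norm_sum.
Qed.

End one_cell.

Section ball_cosine.
Context (t : 'I_m) (y : V) (r C1 C2 : R) (c : set V -> 'I_m -> R[i]).
Hypothesis C1_gt0 : 0 < C1.
Hypothesis dual : forall U : set V, open U -> U !=set0 -> U `<=` eball y r ->
  forall s, \sum_(i < m) c U i * rho mu h i s U = (t == s)%:R.
Hypothesis tv_bound : forall i s (U : set V), open U -> U `<=` eball y r ->
  (rho_tv mu h i s U <= (C1 * cabs (rho mu h i s U))%:E)%E.
Hypothesis dual_bound : forall s (U : set V), open U -> U `<=` eball y r ->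
  \sum_(i < m) cabs (c U i * rho mu h i s U) <= C2.

Lemma H0_limit_cos (L A b : R) xi0 : 0 < L -> eball y r xi0 ->
  H0_limit L (fun s x => (t == s)%:R * (A * cos (dotp x xi0 + b))).
Proof.
move=> L0 yxi e e0.
(* This is (A / 2) e^(-ib), for which 2 Re (a e^(-i<x,xi0>)) = A cos (<x,xi0> + b). *)
pose a : R[i] := Complex (A / 2 * cos b) (- (A / 2 * sin b)).
(* Bounds the L^1 norms of [P s] and [Q s] for every cell, so it can be fixed before eta is
   chosen. *)
pose K := 2 * C1 * cabs a * `|C2|.
have K0 : 0 <= K by rewrite !mulr_ge0 ?cabs_ge0// ltW.
pose X := \sum_j `|xi0 0 j|.
have X0 : 0 <= X by apply: sumr_ge0.
(* Per unit of eta, n L comes from the values and 1 + X n L from the derivatives. The 4 is the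
   doubling due to the reflected cell times the two integrals, of [P s] and of [Q s]. *)
pose D := 4 * K * (n%:R * L + 1 + X * (n%:R * L)).
have nL0 : 0 <= n%:R * L by rewrite mulr_ge0 ?ler0n// ltW.
have XnL : 0 <= X * (n%:R * L) by rewrite mulr_ge0.
have D0 : 0 <= D by apply: mulr_ge0; [rewrite mulr_ge0|lra].
have /nbhs_ballP[eta0 /= eta0_gt0 eta0U] : nbhs xi0 (eball y r).
  by apply: open_nbhs_nbhs; split=> //; exact: eball_open.
pose eta := Num.min eta0 (e / (D + 1)).
have D1 : 0 < D + 1 by lra.
have eta_gt0 : 0 < eta by rewrite lt_min eta0_gt0 divr_gt0.
have De : D * eta <= e.
  have : eta <= e / (D + 1) by rewrite ge_min lexx orbT.
  by rewrite ler_pdivlMr//; nra.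
pose U := around xi0 eta.
have UE : U = ball xi0 eta by exact: aroundE.
have oU : open U by rewrite UE; exact: ball_open.
have U0 : U !=set0 by exists xi0; rewrite UE; exact: ballxx.
have UB : U `<=` eball y r.
  by rewrite UE => x xx; apply: eta0U; apply: le_ball xx; rewrite ge_min lexx.
pose g i := a * c U i.
pose ind : BRn R n -> R := \1_U.
pose P s (xi : BRn R n) := \sum_i complex.Re (g i * h i s xi) * ind xi.
pose Q s (xi : BRn R n) := \sum_i complex.Im (g i * h i s xi) * ind xi.
have cell_itg i s := itg_cell spec (xi0 - const_mx eta) (xi0 + const_mx eta) i s (g i).
have iP s : itg mu (P s) by apply: itg_sum => i; case: (cell_itg i s).
have iQ s : itg mu (Q s) by apply: itg_sum => i; case: (cell_itg i s).
have ind0 (xi : BRn R n) : ind xi != 0 -> forall j, `|(xi : V) 0 j - xi0 0 j| <= eta.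
  rewrite /ind indicE; case: (boolP (xi \in U)); last by rewrite eqxx.
  rewrite inE UE => /(rV_ballP _ _ eta_gt0) H _ j.
  by rewrite distrC ltW.
have P0 s (xi : BRn R n) : P s xi != 0 -> forall j, `|(xi : V) 0 j - xi0 0 j| <= eta.
  move=> PP; apply: ind0; apply: contraNneq PP => E.
  by rewrite /P big1// => i _; rewrite E mulr0.
have Q0 s (xi : BRn R n) : Q s xi != 0 -> forall j, `|(xi : V) 0 j - xi0 0 j| <= eta.
  move=> PP; apply: ind0; apply: contraNneq PP => E.
  by rewrite /Q big1// => i _; rewrite E mulr0.
have sum_g s : \sum_i g i * rho mu h i s U = a * (t == s)%:R.
  by rewrite -(dual oU U0 UB s) mulr_sumr; apply: eq_bigr => i _; rewrite mulrA.
have intP s : Rintegral mu setT (P s) = complex.Re a * (t == s)%:R.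
  rewrite Rint_sum; last by move=> i; case: (cell_itg i s).
  under eq_bigr => i _ do rewrite (proj1 (Rint_cell oU i s (g i))).
  by rewrite -cRe_sum sum_g cReM; case: (t == s) => /=; ring.
have intQ s : Rintegral mu setT (Q s) = complex.Im a * (t == s)%:R.
  rewrite Rint_sum; last by move=> i; case: (cell_itg i s).
  under eq_bigr => i _ do rewrite (proj2 (Rint_cell oU i s (g i))).
  by rewrite -cIm_sum sum_g cImM; case: (t == s) => /=; ring.
have sumK s : \sum_i 2 * cabs (g i) * (C1 * cabs (rho mu h i s U)) <= K.
  rewrite (eq_bigr (fun i => 2 * C1 * cabs a * cabs (c U i * rho mu h i s U))); last first.
    by move=> i _; rewrite /g !cabsM; ring.
  have K1 : 0 <= 2 * C1 * cabs a by rewrite !mulr_ge0 ?cabs_ge0// ltW.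
  rewrite -mulr_sumr; apply: ler_wpM2l => //.
  exact: le_trans (dual_bound s oU UB) (ler_norm _).
have nP s : Rintegral mu setT (fun xi => `|P s xi|) <= K.
  apply: le_trans (sumK s); apply: Rint_norm_sum => i.
    by case: (cell_itg i s).
  exact: (proj1 (Rint_norm_cell oU (g i) (tv_bound i s oU UB))).
have nQ s : Rintegral mu setT (fun xi => `|Q s xi|) <= K.
  apply: le_trans (sumK s); apply: Rint_norm_sum => i.
    by case: (cell_itg i s).
  exact: (proj2 (Rint_norm_cell oU (g i) (tv_bound i s oU UB))).
exists (fun s x => 2 * (cosint mu (P s) 0 x + cosint mu (Q s) (- (pi / 2)) x)).
have der s x j := derM (dercst 2 x (evec R j))
  (derD (cosint_der (iP s) (P0 s) 0 x j) (cosint_der (iQ s) (Q0 s) (- (pi / 2)) x j)).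
split.
- exact: (H0_bounded_cell spec).
- by move=> s x j; case: (der s x j).
move=> s x Kx; split=> [|j].
  have EP := cosint_near (iP s) (P0 s) 0 Kx.
  have EQ := cosint_near (iQ s) (Q0 s) (- (pi / 2)) Kx.
  rewrite intP in EP; rewrite intQ in EQ.
  set p := cosint _ _ _ _ in EP *; set q := cosint _ _ _ _ in EQ *.
  have -> : 2 * (p + q) - (t == s)%:R * (A * cos (dotp x xi0 + b)) =
      2 * (p - complex.Re a * (t == s)%:R * cos (0 + dotp x xi0)) +
      2 * (q - complex.Im a * (t == s)%:R * cos (- (pi / 2) + dotp x xi0)).
    by rewrite add0r (addrC (- _)) cosBpihalf cosD /a /=; field.
  apply: le_trans (ler_normD _ _) _; rewrite !normrM ger0_norm//.
  have nLe : 0 <= n%:R * (L * eta) by rewrite mulrA mulr_ge0// ltW.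
  have := ler_wpM2l nLe (nP s); have := ler_wpM2l nLe (nQ s).
  have : 4 * K * (n%:R * (L * eta)) <= D * eta.
    rewrite /D -[X in _ <= X]mulrA; apply: ler_wpM2l; first by rewrite mulr_ge0.
    have : 0 <= X * (n%:R * L) * eta by rewrite mulr_ge0// ltW.
    by rewrite !mulrDl mul1r (mulrA n%:R); lra.
  by move=> ? ? ?; lra.
have EP := dcosint_near (iP s) (P0 s) 0 j Kx.
have EQ := dcosint_near (iQ s) (Q0 s) (- (pi / 2)) j Kx.
rewrite intP (partialE (cosint_der (iP s) (P0 s) 0 x j)) in EP.
rewrite intQ (partialE (cosint_der (iQ s) (Q0 s) (- (pi / 2)) x j)) in EQ.
rewrite (partialE (der s x j)) mulr0 addr0.
have -> : partial (fun x => (t == s)%:R * (A * cos (dotp x xi0 + b))) j x =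
    (t == s)%:R * (A * (- xi0 0 j * sin (dotp x xi0 + b))).
  have C := C1cos b xi0.
  rewrite (partialM j x (C1cst _) (C1M (C1cst A) C)) (partialM j x (C1cst A) C).
  by rewrite !partialcst partial_cos; ring.
set p := Rintegral _ _ _ in EP *; set q := Rintegral _ _ _ in EQ *.
have -> : 2 * (p + q) - (t == s)%:R * (A * (- xi0 0 j * sin (dotp x xi0 + b))) =
    2 * (p - complex.Re a * (t == s)%:R * (- xi0 0 j * sin (0 + dotp x xi0))) +
    2 * (q - complex.Im a * (t == s)%:R * (- xi0 0 j * sin (- (pi / 2) + dotp x xi0))).
  by rewrite add0r (addrC (- _)) sinBpihalf sinD /a /=; field.
apply: le_trans (ler_normD _ _) _; rewrite !normrM ger0_norm//.
have jX : `|xi0 0 j| <= X.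
  rewrite /X (bigD1 j)//= lerDl; exact: sumr_ge0.
have nLe : 0 <= n%:R * (L * eta) by rewrite mulrA mulr_ge0// ltW.
have e1 : 0 <= eta + `|xi0 0 j| * (n%:R * (L * eta)).
  by rewrite addr_ge0// ?mulr_ge0// ltW.
have := ler_wpM2l e1 (nP s); have := ler_wpM2l e1 (nQ s).
have : 4 * K * (eta + `|xi0 0 j| * (n%:R * (L * eta))) <= D * eta.
  rewrite /D -[X in _ <= X]mulrA; apply: ler_wpM2l; first by rewrite mulr_ge0.
  rewrite !mulrDl mul1r.
  have : `|xi0 0 j| * (n%:R * (L * eta)) <= X * (n%:R * L) * eta.
    by rewrite (mulrA n%:R) -[X in _ <= X]mulrA ler_wpM2r// mulr_ge0// ltW.
  have : 0 <= n%:R * L * eta by rewrite mulr_ge0// ltW.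
  by move=> ? ?; lra.
by move=> ? ? ?; lra.
Qed.

Lemma H0_limit_trig (L : R) Xi f : 0 < L -> Xi `<=` eball y r -> trig Xi f ->
  H0_limit L (fun s x => (t == s)%:R * f x).
Proof.
move=> L0 XiB; elim=> [A b xi Xxi|{}f f' tf IH tf' IH'].
  by apply: H0_limit_cos => //; exact: XiB.
have -> : (fun s x => (t == s)%:R * (f x + f' x)) =
  (fun s x => (t == s)%:R * f x + (t == s)%:R * f' x).
  by apply/funext => s; apply/funext => x; rewrite mulrDr.
have dz (u : V -> R) s : C1on setT u -> derivable_everywhere (fun x => (t == s)%:R * u x).
  by move=> Cu; apply: C1_derivable; apply: C1M => //; exact: C1cst.
by apply: H0_limitD => // s; apply: dz; [exact: trig_C1 tf|exact: trig_C1 tf'].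
Qed.

End ball_cosine.
End concentration.

(** * From single components to the density theorem *)

Lemma H0_limit_sum (R : realType) (n m : nat) (mu : {finite_measure set (BRn R n) -> \bar R})
    (h : 'I_m -> 'I_m -> BRn R n -> R[i]) (k : 'I_m -> 'I_m -> 'rV[R]_n -> R) (L : R)
    (I : Type) (s : seq I) (Tg : I -> 'I_m -> 'rV[R]_n -> R) :
  spectral_measure_of mu h k -> (forall a i, C1on setT (Tg a i)) ->
  (forall a, H0_limit mu h L (Tg a)) ->
  H0_limit mu h L (fun i x => \sum_(a <- s) Tg a i x).
Proof.
move=> spec CT A; elim: s => [|a s IH].
  rewrite (_ : (fun _ _ => _) = (fun _ _ => 0)); first exact: H0_limit0.
  by apply/funext => i; apply/funext => x; rewrite big_nil.
rewrite (_ : (fun _ _ => _) = (fun i x => Tg a i x + \sum_(b <- s) Tg b i x)); last first.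
  by apply/funext => i; apply/funext => x; rewrite big_cons.
by apply: (H0_limitD spec) => // i; apply: C1_derivable => //; exact: C1sum.
Qed.

(** [C1dist] adds two suprema; eps / 4 for each leaves room for the strict inequality. *)
Lemma C1dist_lt (R : realType) (n m : nat) (B : set 'rV[R]_n)
    (F G : 'I_m -> 'rV[R]_n -> R) (eps : R) : 0 < eps ->
  (forall i x, B x -> `|F i x - G i x| <= eps / 4 /\
     forall j, `|partial (F i) j x - partial (G i) j x| <= eps / 4) ->
  (C1dist B F G < eps%:E)%E.
Proof.
move=> e0 H; rewrite /C1dist.
apply: (@le_lt_trans _ _ ((eps / 4)%:E + (eps / 4)%:E)%E).
  apply: leeD; apply: ge_ereal_sup => z.
    by move=> [i [x [Bx ->]]]; rewrite lee_fin; case: (H i x Bx).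
  by move=> [i [j [x [Bx ->]]]]; rewrite lee_fin; case: (H i x Bx) => _ /(_ j).
by rewrite -EFinD lte_fin; lra.
Qed.

Theorem theoremC1 (R : realType) (n m : nat)
  (d : measure_display) (Omega : measurableType d) (P : probability Omega R)
  (F : 'I_m -> 'rV[R]_n -> {RV P >-> R})
  (k : 'I_m -> 'I_m -> 'rV[R]_n -> R)
  (mu : {finite_measure set (BRn R n) -> \bar R})
  (h : 'I_m -> 'I_m -> BRn R n -> R[i]) :
  centered_gaussian_field F ->
  stationary_cov F k ->
  as_C3minus F ->
  spectral_measure_of mu h k ->
  m_balls_abs_nondeg mu h ->
  forall B : set 'rV[R]_n, open B -> bounded_set B ->
  forall G : 'I_m -> 'rV[R]_n -> R,
    (exists U : set 'rV[R]_n, open U /\ closure B `<=` U /\ forall i, C1on U (G i)) ->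
  forall eps : R, 0 < eps ->
  exists H, H0 mu h H /\ (C1dist B H G < eps%:E)%E.
Proof.
move=> _ _ _ spec [y [r [c [C1 [C2 [r0 [C10 [C20 [dual [tv dualb]]]]]]]]]].
move=> B oB bB G [U [oU [BU CG]]] eps eps0.
have [L [L0 BL]] : exists L : R, 0 < L /\ B `<=` box L.
  have [M [_ HM]] := bB; exists (`|M| + 1); split; first by rewrite ltr_wpDl.
  move=> x Bx j; have := HM (`|M| + 1); rewrite (le_lt_trans (ler_norm M)) ?ltrDl//.
  move=> /(_ isT x Bx); apply: le_trans.
  by rewrite [leRHS]/Num.norm /= mx_normrE; apply/bigmax_geP; right; exists (0, j).
have /choice[g Hg] i : exists g, C1on setT g /\
    forall x, B x -> g x = G i x /\ forall j, partial g j x = partial (G i) j x.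
  exact: C1_extension (CG i).
(* One eighth for replacing [g] by trigonometric sums, one eighth for replacing these by a member of
   H_0: together the eps / 4 of [C1dist_lt]. *)
have e8 : 0 < eps / 8 by lra.
have rn t : 0 < r t / n.+1%:R by rewrite divr_gt0.
have /choice[f Hf] t : exists f, trig (cube (y t) (r t / n.+1%:R)) f /\ clo L (g t) f (eps / 8).
  by apply: trig_dense => //; case: (Hg t).
have lim : H0_limit mu h L (fun s x => \sum_(t < m) (t == s)%:R * f t x).
  apply: (@H0_limit_sum _ _ _ _ _ _ _ _ _ (fun t s x => (t == s)%:R * f t x) spec).
    by move=> t s; apply: C1M; [exact: C1cst|exact: trig_C1 (Hf t).1].
  move=> t; apply: (@H0_limit_trig _ _ _ _ _ _ spec t (y t) (r t) C1 C2 (c t) C10 _ _ _ L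
    (cube (y t) (r t / n.+1%:R))) => //.
  - by move=> V oV V0 VB s; exact: dual.
  - by move=> i s V oV VB; apply: tv => // x /VB; exists t.
  - by move=> s V oV VB; exact: dualb.
  - exact: cube_eball.
  - by case: (Hf t).
have fE : (fun s x => \sum_(t < m) (t == s)%:R * f t x) = f.
  apply/funext => s; apply/funext => x; rewrite (bigD1 s)//= eqxx mul1r big1 ?addr0// => t ts.
  by rewrite (negbTE ts) mul0r.
rewrite fE in lim.
have [H [HH _ cH]] := lim _ e8.
exists H; split; first exact: H0_boundedW spec _ HH.
apply: C1dist_lt => // i x Bx.
have [_ /(_ x Bx)[E1 E2]] := Hg i; have [_ /(_ x (BL x Bx))[a1 b1]] := Hf i.
have [a2 b2] := cH i x (BL x Bx).
split=> [|j].
  rewrite -E1; have := ler_distD (f i x) (H i x) (g i x).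
  by rewrite (distrC (f i x)); lra.
rewrite -E2; have := ler_distD (partial (f i) j x) (partial (H i) j x) (partial (g i) j x).
by rewrite (distrC (partial (f i) j x)); have := b1 j; have := b2 j; lra.
Qed.
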